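(* For every MCFTG $G$ with terminal alphabet $\Sigma$ and $\theta(G)\ge 1$ there is an $\mathrm{LDT}^{\mathrm R}$-equivalent footed MCFTG $G'$ such that $\mu(G')\le\mu(G)\cdot\mathrm{mr}_\Sigma\cdot(2\cdot\theta(G)-1)$. Moreover, for $\Delta\subseteq\Sigma$, if $G$ is $\Delta$-lexicalized, then so is $G'$.
   Context: **Sequences and trees.** $\mathbb N_0$ is the set of nonnegative integers, $[n]=\{1,\dots,n\}$. $A^*$ (resp. $A^+$) is the set of finite (resp. nonempty finite) sequences over $A$; a sequence of length 1 is identified with its element; juxtaposition is concatenation; $\mathrm{occ}(w)$ is the set of elements occurring in the sequence $w$; $w$ is repetition-free if no element occurs twice in it. A ranked alphabet is a set $\Sigma$ with a rank map $\mathrm{rk}\colon\Sigma\to\mathbb N_0$ (applied elementwise to sequences); $\Sigma^{(k)}$ is the set of symbols of rank $k$; for finite $\Sigma$, $\mathrm{mr}_\Sigma$ is the maximal rank of its symbols. $T_\Sigma$ is the set of trees over $\Sigma$: the smallest set of strings over $\Sigma$ containing $\sigma t_1\cdots t_k$ (also written $\sigma(t_1,\dots,t_k)$) for all $\sigma\in\Sigma^{(k)}$ and $t_i\in T_\Sigma$. A forest is a finite sequence of trees. $X=\{x_1,x_2,\dots\}$ is a set of variables (of rank 0, disjoint from other alphabets), $X_k=\{x_1,\dots,x_k\}$. A pattern of rank $k$ over $\Sigma$ is a tree over $\Sigma\cup X_k$ in which each of $x_1,\dots,x_k$ occurs exactly once; $P_\Sigma(X_k)$ is the set of these and $P_\Sigma(X)=\bigcup_k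 P_\Sigma(X_k)$. For a forest $t$, $\mathrm{occ}_\Omega(t)$ is the set of symbols of $\Omega$ occurring in $t$; $t$ is uniquely $\Omega$-labeled if each symbol of $\Omega$ occurs at most once in $t$. **Substitution.** For a repetition-free sequence of symbols $\sigma=(\sigma_1,\dots,\sigma_n)$ and patterns $u=(u_1,\dots,u_n)$ with $\mathrm{rk}(u)=\mathrm{rk}(\sigma)$, $t[\sigma\gets u]$ is obtained from $t$ by replacing, recursively, each subtree $\sigma_i(s_1,\dots,s_k)$ by $u_i$ in which $x_j$ is replaced by the transformed $s_j$ (componentwise on forests). For $\mathcal L=\{B_1,\dots,B_k\}$ with $B_1\cdots B_k$ repetition-free and forests $f(B_i)$ with $\mathrm{rk}(f(B_i))=\mathrm{rk}(B_i)$, $t[B\gets f(B)\mid B\in\mathcal L]$ means $t[B_1\cdots B_k\gets f(B_1)\cdots f(B_k)]$. **MCFTG.** A multiple context-free tree grammar (MCFTG) is $G=(N,\mathcal N,\Sigma,S,R)$ where $N$ is a finite ranked alphabet of nonterminals; $\mathcal N\subseteq N^+$ is a finite set of repetition-free sequences (big nonterminals) with $\mathrm{occ}(A)\ne\mathrm{occ}(A')$ for distinct $A,A'\in\mathcal N$; $\Sigma$ is a finite ranked alphabet of terminals, disjoint from $N$, with $\mathrm{mr}_\Sigma\ge1$; $S\in\mathcal N\cap N^{(0)}$ is the initial nonterminal; $R$ is a finite set of rules $A\to(u,\mathcal L)$ with $A\in\mathcal N$, $u\in P_{N\cup\Sigma}(X)^+$ a uniquely $N$-labeled forest with $\mathrm{rk}(u)=\mathrm{rk}(A)$,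 and $\mathcal L\subseteq\mathcal N$ (the links) such that the sets $\mathrm{occ}(B)$, $B\in\mathcal L$, are pairwise disjoint with union $\mathrm{occ}_N(u)$. The sets $L(G,A)$, $A\in\mathcal N$, are simultaneously the smallest sets of forests such that for every rule $A\to(u,\mathcal L)$ and all $f(B)\in L(G,B)$ ($B\in\mathcal L$), $u[B\gets f(B)\mid B\in\mathcal L]\in L(G,A)$. $L(G)=L(G,S)\subseteq T_\Sigma$. The multiplicity is $\mu(G)=\max\{|A|: A\in\mathcal N\}$; the width is $\theta(G)=\max\{\mathrm{rk}(C): C\in N\}$. Convention: every MCFTG is start-separated, i.e. $S$ does not occur in right-hand sides of rules. **Derivation trees.** For every rule fix a linear order on its links; a rule with $k$ links has rank $k$, so $R$ is a ranked alphabet. The sets $L(G_{\mathrm{der}},A)\subseteq T_R$ are the smallest sets such that $\rho(d_1,\dots,d_k)\in L(G_{\mathrm{der}},A)$ whenever $\rho=A\to(u,\{B_1,\dots,B_k\})\in R$ (links in their order) and $d_i\in L(G_{\mathrm{der}},B_i)$; and $\mathrm{val}(\rho(d_1,\dots,d_k))=u[B_i\gets\mathrm{val}(d_i)\mid 1\le i\le k]$. $L(G_{\mathrm{der}})=L(G_{\mathrm{der}},S)$. **$\mathrm{LDT}^{\mathrm R}$-equivalence.** A linear deterministic top-down tree transducer with regular look-ahead ($\mathrm{LDT}^{\mathrm R}$-transducer) from $\Omega$ to $\Sigma$ has a finite state set $Q$, an initial state $q_0$, and finitely many rules $\langle q,\omega(y_1{:}L_1,\dots,y_k{:}L_k){:}L_0\rangle\to\zeta$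 with $q\in Q$, $\omega\in\Omega^{(k)}$, $L_0,\dots,L_k$ regular tree languages over $\Omega$, and $\zeta$ a tree over $\Sigma$ and rank-0 symbols $\langle q',y_i\rangle$ ($q'\in Q$, $i\in[k]$) in which each $y_i$ occurs at most once; for two distinct rules with the same $q,\omega$ and look-ahead languages $L_i$, $L_i'$ there is $0\le i\le k$ with $L_i\cap L_i'=\emptyset$. For $s=\omega(s_1,\dots,s_k)$, $M_q(s)=\zeta[\langle q',y_i\rangle\gets M_{q'}(s_i)]$ if there is a rule $\langle q,\omega(y_1{:}L_1,\dots,y_k{:}L_k){:}L_0\rangle\to\zeta$ with $s\in L_0$, $s_i\in L_i$ for all $i\in[k]$ (undefined if there is no such rule or some needed $M_{q'}(s_i)$ is undefined); it realizes the partial function $M=M_{q_0}\colon T_\Omega\to T_\Sigma$. MCFTGs $G,G'$ with the same terminal alphabet and rule sets $R,R'$ are $\mathrm{LDT}^{\mathrm R}$-equivalent if there are such transductions $M\colon T_R\to T_{R'}$, $M'\colon T_{R'}\to T_R$ with $M(d)\in L(G'_{\mathrm{der}})$ and $\mathrm{val}(M(d))=\mathrm{val}(d)$ for all $d\in L(G_{\mathrm{der}})$, and $M'(d')\in L(G_{\mathrm{der}})$ and $\mathrm{val}(M'(d'))=\mathrm{val}(d')$ for all $d'\in L(G'_{\mathrm{der}})$ (so $L(G)=L(G')$). **Lexicalization.** A rule $A\to(u,\mathcal L)$ is initial if $A=S$, terminal if $\mathcal L=\emptyset$, proper if it is not both initial and terminal, and $\Delta$-lexicalized if some symbol of $\Delta$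 occurs in $u$. $G$ is $\Delta$-lexicalized if all its proper rules are. **Footed.** A pattern $t\in P_{N\cup\Sigma}(X_k)$ is footed if either $k=0$, or $k\ge1$ and $t$ has a node (the foot node) labeled by a symbol of $N\cup\Sigma$ of rank $k$ whose $i$-th child is labeled $x_i$ for every $i\in[k]$. An MCFTG is footed if for each of its rules $A\to((u_1,\dots,u_n),\mathcal L)$ all $u_j$ are footed. *)

(* Defs.v *)
From mathcomp Require Import all_boot.
From Stdlib Require List.

Set Implicit Arguments.
Unset Strict Implicit.
Unset Printing Implicit Defensive.

(** Ranked alphabets and trees *)

Record rankedAlphabet := RankedAlphabet {
  symbol :> finType;
  rk : symbol -> nat
}.

Definition maxrank (A : rankedAlphabet) : nat := \max_(a : A) rk a.

(* Trees with inner symbols in [A] and extra rank-0 symbols in [X].  Trees over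
   a ranked alphabet [A] alone are the [ranked] elements of [tree A void]; for
   patterns [X] is [nat], and [Leaf i] is the variable x_(i+1). *)
Inductive tree (A X : Type) :=
  | Leaf of X
  | Node of A & seq (tree A X).

Arguments Leaf {A X} _.
Arguments Node {A X} _ _.

Section Trees.

Variables A X : Type.

Fixpoint ranked (rnk : A -> nat) (t : tree A X) : bool :=
  match t with
  | Leaf _ => true
  | Node a ts => (size ts == rnk a) && all (ranked rnk) ts
  end.

Fixpoint leaves (t : tree A X) : seq X :=
  match t with
  | Leaf x => [:: x]
  | Node _ ts => flatten (map leaves ts)
  end.

Fixpoint labels (t : tree A X) : seq A :=
  match t with
  | Leaf _ => [::]
  | Node a ts => a :: flatten (map labels ts)
  end.

Fixpoint subtrees (t : tree A X) : seq (tree A X) :=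
  t :: match t with
       | Leaf _ => [::]
       | Node _ ts => flatten (map subtrees ts)
       end.

Fixpoint graft (Y : Type) (g : X -> tree A Y) (t : tree A X) : tree A Y :=
  match t with
  | Leaf x => g x
  | Node a ts => Node a (map (graft g) ts)
  end.

End Trees.

Definition pattern (A : Type) (rnk : A -> nat) (k : nat) (t : tree A nat) :
    bool :=
  ranked rnk t && perm_eq (leaves t) (iota 0 k).

Definition footed_pattern (A : Type) (rnk : A -> nat) (k : nat)
    (t : tree A nat) : Prop :=
  k = 0 \/
  (1 <= k /\ exists a : A,
     rnk a = k /\ List.In (Node a (map Leaf (iota 0 k))) (subtrees t)).

(** Multiple context-free tree grammars *)

Section Forests.

Variables (N Sigma : rankedAlphabet).

Definition sum_rk (a : N + Sigma) : nat :=
  match a with inl C => rk C | inr s => rk s end.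

Definition forest_labels (u : seq (tree (N + Sigma) nat)) : seq (N + Sigma) :=
  flatten (map (@labels _ _) u).

Definition nonterminals (u : seq (tree (N + Sigma) nat)) : seq N :=
  pmap (fun a => match a with inl C => Some C | inr _ => None end)
       (forest_labels u).

(* [f] gives the pattern substituted for each nonterminal.  It is used only
   where every nonterminal of the tree is replaced, so the result is a tree
   over [Sigma]; this makes values in different grammars comparable. *)
Fixpoint subst (f : N -> tree Sigma nat) (t : tree (N + Sigma) nat) :
    tree Sigma nat :=
  match t with
  | Leaf j => Leaf j
  | Node (inl C) ts => graft (fun j => nth (Leaf j) (map (subst f) ts) j) (f C)
  | Node (inr s) ts => Node s (map (subst f) ts)
  end.

(* u[B_1 ... B_k <- w_1 ... w_k] on forests; the default [Leaf 0] is reached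
   only for nonterminals outside occ(B_1 ... B_k). *)
Definition forest_subst (Bs : seq (seq N)) (ws : seq (seq (tree Sigma nat)))
    (u : seq (tree (N + Sigma) nat)) : seq (tree Sigma nat) :=
  map (subst (fun C => nth (Leaf 0) (flatten ws) (index C (flatten Bs)))) u.

End Forests.

(* The finite set of rules is given as a finite type with an injective
   description of each rule (see [mcftg_rule_inj]).  The links of a rule form
   a set; they are listed without repetition in the linear order that turns
   the set of rules into a ranked alphabet. *)
Record mcftg (Sigma : rankedAlphabet) := Mcftg {
  nonterm : rankedAlphabet;
  big : seq (seq nonterm);
  start : nonterm;
  grule : finType;
  lhs : grule -> seq nonterm;
  rhs : grule -> seq (tree (nonterm + Sigma) nat);
  links : grule -> seq (seq nonterm);

  mcftg_maxrank : 1 <= maxrank Sigma;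
  mcftg_big_nonempty : forall A, A \in big -> A != [::];
  mcftg_big_uniq : forall A, A \in big -> uniq A;
  mcftg_big_occ : forall A A', A \in big -> A' \in big ->
    [set:: A] = [set:: A'] -> A = A';
  mcftg_start_big : [:: start] \in big;
  mcftg_start_rk : rk start = 0;
  mcftg_rule_inj : forall r r' : grule,
    lhs r = lhs r' -> rhs r = rhs r' -> links r =i links r' -> r = r';
  mcftg_lhs_big : forall r, lhs r \in big;
  mcftg_rhs_pattern : forall r,
    all2 (fun C t => pattern (@sum_rk nonterm Sigma) (rk C) t) (lhs r) (rhs r);
  mcftg_rhs_uniq : forall r, uniq (nonterminals (rhs r));
  mcftg_links_uniq : forall r, uniq (links r);
  mcftg_links_big : forall r, {subset links r <= big};
  mcftg_links_disjoint : forall r B B', B \in links r -> B' \in links r ->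
    B != B' -> [disjoint [set:: B] & [set:: B']];
  mcftg_links_cover : forall r,
    \bigcup_(B <- links r) [set:: B] = [set:: nonterminals (rhs r)];
  (* start-separated *)
  mcftg_start_sep : forall r, start \notin nonterminals (rhs r)
}.

Section Grammar.

Variables (Sigma : rankedAlphabet) (G : mcftg Sigma).

Definition multiplicity : nat := \max_(A <- big G) size A.

Definition width : nat := maxrank (nonterm G).

Definition initial_rule (r : grule G) : bool := lhs r == [:: start G].

Definition terminal_rule (r : grule G) : bool := links r == [::].

Definition proper_rule (r : grule G) : bool :=
  ~~ (initial_rule r && terminal_rule r).

Definition lexicalized_rule (Delta : {set Sigma}) (r : grule G) : Prop :=
  exists2 s : Sigma, s \in Delta & inr s \in forest_labels (rhs r).

Definition lexicalized (Delta : {set Sigma}) : Prop :=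
  forall r : grule G, proper_rule r -> lexicalized_rule Delta r.

Definition footed : Prop :=
  forall r : grule G,
    List.Forall2
      (fun C t => footed_pattern (@sum_rk (nonterm G) Sigma) (rk C) t)
      (lhs r) (rhs r).

Definition rule_alphabet : rankedAlphabet :=
  @RankedAlphabet (grule G) (fun r => size (links r)).

Inductive der_from : seq (nonterm G) -> tree rule_alphabet void -> Prop :=
  | Der_from (r : rule_alphabet) (ds : seq (tree rule_alphabet void)) :
      List.Forall2 der_from (links r) ds -> der_from (lhs r) (Node r ds).

Definition der (d : tree rule_alphabet void) : Prop := der_from [:: start G] d.

Fixpoint val (d : tree rule_alphabet void) : seq (tree Sigma nat) :=
  match d with
  | Leaf x => of_void _ x
  | Node r ds => forest_subst (links r) (map val ds) (rhs r)
  end.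

End Grammar.

(** Regular tree languages and tree transducers *)

Fixpoint run (A P : Type) (delta : A -> seq P -> P) (t : tree A void) : P :=
  match t with
  | Leaf x => of_void _ x
  | Node a ts => delta a (map (run delta) ts)
  end.

(* recognizability by a (total) deterministic bottom-up finite tree automaton *)
Definition regular (Omega : rankedAlphabet) (L : tree Omega void -> Prop) :
    Prop :=
  exists (P : finType) (delta : Omega -> seq P -> P) (F : {set P}),
    forall t, L t <-> (ranked (@rk Omega) t /\ run delta t \in F).

(* The rule [r] is <q, w(y_1 : L_1, ..., y_k : L_k) : L_0> -> zeta with
   q = [tstate r], w = [tsymb r], L_i = [tlook r i] (relevant for i <= k only)
   and zeta = [tzeta r], where the leaf (q', i) is <q', y_(i+1)>. *)
Record ldtr (Omega Sigma : rankedAlphabet) := Ldtr {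
  state : finType;
  state0 : state;
  trule : finType;
  tstate : trule -> state;
  tsymb : trule -> Omega;
  tlook : trule -> nat -> tree Omega void -> Prop;
  tzeta : trule -> tree Sigma (state * nat);

  ldtr_regular : forall r i, i <= rk (tsymb r) -> regular (tlook r i);
  ldtr_ranked : forall r, ranked (@rk Sigma) (tzeta r);
  ldtr_bound : forall r q i,
    (q, i) \in leaves (tzeta r) -> i < rk (tsymb r);
  ldtr_linear : forall r, uniq (map snd (leaves (tzeta r)));
  ldtr_deterministic : forall r r', r != r' ->
    tstate r = tstate r' -> tsymb r = tsymb r' ->
    exists2 i, i <= rk (tsymb r) & forall t, ~ (tlook r i t /\ tlook r' i t)
}.

(* [transduces M q s t] is M_q(s) = t; by determinism it is functional in [s],
   and M_q(s) is undefined when no [t] exists. *)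
Inductive transduces (Omega Sigma : rankedAlphabet) (M : ldtr Omega Sigma) :
    state M -> tree Omega void -> tree Sigma void -> Prop :=
  | Transduces (r : trule M) (ss : seq (tree Omega void))
      (g : state M * nat -> tree Sigma void) :
      tlook r 0 (Node (tsymb r) ss) ->
      (forall i s, onth ss i = Some s -> tlook r i.+1 s) ->
      (forall q i s, (q, i) \in leaves (tzeta r) -> onth ss i = Some s ->
         transduces q s (g (q, i))) ->
      transduces (tstate r) (Node (tsymb r) ss) (graft g (tzeta r)).

Definition realizes (Omega Sigma : rankedAlphabet) (M : ldtr Omega Sigma)
    (s : tree Omega void) (t : tree Sigma void) : Prop :=
  transduces (state0 M) s t.

Definition ldtr_translates (Sigma : rankedAlphabet) (G G' : mcftg Sigma)
    (M : ldtr (rule_alphabet G) (rule_alphabet G')) : Prop :=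
  forall d, der d -> exists d', [/\ realizes M d d', der d' & val d' = val d].

Definition ldtr_equivalent (Sigma : rankedAlphabet) (G G' : mcftg Sigma) :
    Prop :=
  (exists M : ldtr (rule_alphabet G) (rule_alphabet G'), ldtr_translates M) /\
  (exists M' : ldtr (rule_alphabet G') (rule_alphabet G), ldtr_translates M').

(* Main.v *)
(* Every pattern [t] with variables is cut into footed patterns: one for each
   branching of the paths to the variables and one for each parent of a
   variable, together with the ground trees that hang off them.  The shape of
   this decomposition (the skeleton of [t]) ranges over a finite set, and a
   pattern with [k] variables has at most [mr * (2 * k - 1)] pieces; the pattern
   [x_1] has none.  The nonterminals of [G'] are the places for the pieces of a
   big nonterminal [A] of [G] whose skeletons have been guessed.  A rule of [G]
   gives rules of [G'] by replacing each nonterminal of the right-hand side by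
   its skeleton and decomposing the result; this is sound because substituting
   footed patterns commutes with the decomposition.  Regular look-ahead
   computes the skeletons of a derivation tree of [G].  Big nonterminals with no
   piece at all disappear from the rules of [G'], and the transducer back to [G]
   restores them with fixed derivation trees. *)

Require Import Defs.
From mathcomp Require Import all_boot.
From mathcomp Require Import boolp.
From mathcomp Require Import zify.
From HB Require Import structures.

Set Implicit Arguments.
Unset Strict Implicit.
Unset Printing Implicit Defensive.

(** Where a pattern is cut depends, at each node, only on which children are variables and which are
    ground. Replacing a symbol by a footed pattern of positive rank keeps this information: beside
    the path to the foot everything is ground, so the nodes above the foot join its piece, and the
    foot has the same children as the replaced symbol. Hence the cut of a right-hand side with
    placeholders has the shape of the cut of the actual value.

    A piece with variables has the rank of its foot symbol, so placeholders have rank at most [mr]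
    even if the width of [G] is larger. Cutting trees that contain placeholders therefore obeys the
    same bounds as cutting terminal trees, and the set of skeletons is closed under the rules.

    Every derivation tree has exactly one sequence of skeletons, so different guesses have disjoint
    look-ahead languages. *)

HB.instance Definition _ (A X : Type) := gen_eqMixin (tree A X).
HB.instance Definition _ (A X : Type) := gen_choiceMixin (tree A X).

Lemma tree_nested_ind (A X : Type) (P : tree A X -> Prop) :
  (forall x, P (Leaf x)) ->
  (forall a ts, {in ts, forall t, P t} -> P (Node a ts)) ->
  forall t, P t.
Proof.
move=> PL PN; fix IH 1 => -[x|a ts]; first exact: PL.
apply: PN; elim: ts => [u /(fun h => notF h) []|t ts IHts u].
by rewrite inE => /predU1P[->|ut]; [exact: (IH t) | exact: (IHts u ut)].
Qed.

(** * Trees and substitution *)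

Section Basics.
Variables A B X : Type.

(** Labels come with their number of children, because in a decomposition this number is the rank of
    the piece. *)
Fixpoint nodes (t : tree A X) : seq (A * nat) :=
  match t with
  | Leaf _ => [::]
  | Node a ts => (a, size ts) :: flatten (map nodes ts)
  end.

Definition arities (t : tree A X) : seq nat := unzip2 (nodes t).

Fixpoint lmap (f : A -> B) (t : tree A X) : tree B X :=
  match t with
  | Leaf x => Leaf x
  | Node a ts => Node (f a) (map (lmap f) ts)
  end.

Lemma unzip1_nodes (t : tree A X) : unzip1 (nodes t) = labels t.
Proof.
elim/tree_nested_ind: t => //= a ts IH; congr cons.
rewrite /unzip1 map_flatten -map_comp; congr flatten.
exact/eq_in_map.
Qed.

Lemma size_labels (t : tree A X) : size (labels t) = size (nodes t).
Proof. by rewrite -unzip1_nodes size_map. Qed.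

Lemma arities_node a (ts : seq (tree A X)) :
  arities (Node a ts) = size ts :: flatten (map arities ts).
Proof. by rewrite /arities /unzip2 /= map_flatten -map_comp. Qed.

Lemma labels_lmap (f : A -> B) (t : tree A X) :
  labels (lmap f t) = map f (labels t).
Proof.
elim/tree_nested_ind: t => //= a ts IH; congr cons.
by rewrite map_flatten -!map_comp; congr flatten; apply/eq_in_map.
Qed.

Lemma leaves_lmap (f : A -> B) (t : tree A X) : leaves (lmap f t) = leaves t.
Proof.
elim/tree_nested_ind: t => //= a ts IH.
by rewrite -!map_comp; congr flatten; apply/eq_in_map.
Qed.

Lemma leaves_graft (Y : Type) (g : X -> tree A Y) t :
  leaves (graft g t) = flatten (map (fun x => leaves (g x)) (leaves t)).
Proof.
elim/tree_nested_ind: t => [x|a ts IH] /=; first by rewrite cats0.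
elim: ts IH => //= t ts IHts IH; rewrite map_cat flatten_cat IH ?mem_head //.
by congr cat; apply: IHts => u uts; apply: IH; rewrite inE uts orbT.
Qed.

End Basics.

Lemma arities_lmap A B X (f : A -> B) (t : tree A X) :
  arities (lmap f t) = arities t.
Proof.
elim/tree_nested_ind: t => //= a ts IH; rewrite !arities_node size_map.
by congr cons; rewrite -map_comp; congr flatten; apply/eq_in_map.
Qed.

Lemma lmap_comp A B C X (f : B -> C) (g : A -> B) (t : tree A X) :
  lmap f (lmap g t) = lmap (f \o g) t.
Proof.
by elim/tree_nested_ind: t => //= a ts IH; congr Node; rewrite -map_comp;
  apply/eq_in_map.
Qed.

Lemma eq_in_graft A Y (eX : eqType) (g h : eX -> tree A Y) (t : tree A eX) :
  {in leaves t, g =1 h} -> graft g t = graft h t.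
Proof.
elim/tree_nested_ind: t => [x|a ts IH] /= gh; first by apply: gh; rewrite mem_head.
congr Node; apply/eq_in_map => t tts; apply: IH => // x xt; apply: gh.
by apply/flattenP; exists (leaves t) => //; apply: map_f.
Qed.

Lemma graft_graft A X Y Z (g : X -> tree A Y) (h : Y -> tree A Z) t :
  graft h (graft g t) = graft (fun x => graft h (g x)) t.
Proof.
by elim/tree_nested_ind: t => //= a ts IH; congr Node; rewrite -map_comp;
  apply/eq_in_map.
Qed.

Lemma graft_Leaf A X (t : tree A X) : graft Leaf t = t.
Proof.
elim/tree_nested_ind: t => //= a ts IH; congr Node.
by rewrite -[RHS]map_id; apply/eq_in_map.
Qed.

Lemma ranked_graft A Y (rnk : A -> nat) (eX : eqType)
    (g : eX -> tree A Y) (t : tree A eX) :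
  ranked rnk t -> {in leaves t, forall x, ranked rnk (g x)} ->
  ranked rnk (graft g t).
Proof.
elim/tree_nested_ind: t => [x|a ts IH] /=; first by move=> _; apply; rewrite mem_head.
move=> /andP[/eqP sz /allP rts] rg; rewrite size_map sz eqxx /=.
apply/allP => _ /mapP[t tts ->]; apply: IH => // [|x xt]; first exact: rts.
by apply: rg; apply/flattenP; exists (leaves t) => //; apply: map_f.
Qed.

Lemma labels_graft (A : eqType) X Y (g : X -> tree A Y) t :
  perm_eq (labels (graft g t))
          (labels t ++ flatten (map (fun x => labels (g x)) (leaves t))).
Proof.
elim/tree_nested_ind: t => [x|a ts IH] /=; first by rewrite cats0.
rewrite perm_cons; elim: ts IH => //= t ts IHts IH.
rewrite map_cat flatten_cat.
have /IHts {}IHts : {in ts, forall t : tree A X, perm_eq (labels (graft g t))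
          (labels t ++ flatten [seq labels (g x) | x <- leaves t])}.
  by move=> u uts; apply: IH; rewrite inE uts orbT.
rewrite perm_sym perm_catACA perm_sym.
by apply: perm_cat => //; apply: IH; rewrite mem_head.
Qed.

(** * Second-order substitution *)

Definition inst A (ts : seq (tree A nat)) (p : tree A nat) : tree A nat :=
  graft (fun j => nth (Leaf j) ts j) p.

Definition corolla A (a : A) (m : nat) : tree A nat :=
  Node a (map Leaf (iota 0 m)).

(** Every label is replaced, terminals included; a symbol that should stay is sent to its corolla.
    This gives one operation for substituting values, skeletons and pieces. *)
Fixpoint gsubst A B (f : A -> tree B nat) (t : tree A nat) : tree B nat :=
  match t with
  | Leaf j => Leaf j
  | Node a ts => inst (map (gsubst f) ts) (f a)
  end.

Lemma map_nth_Leaf A (ts : seq (tree A nat)) :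
  [seq nth (Leaf j) ts j | j <- iota 0 (size ts)] = ts.
Proof.
apply: (@eq_from_nth _ (Leaf 0)); rewrite size_map size_iota // => i lti.
by rewrite (nth_map 0) ?size_iota // nth_iota // add0n; exact: set_nth_default.
Qed.

Lemma inst_corolla A (a : A) ts : inst ts (corolla a (size ts)) = Node a ts.
Proof. by rewrite /inst /corolla /= -map_comp map_nth_Leaf. Qed.

(** The default [Leaf j] of [inst] leaves a variable out of range in place, so the identity holds
    for every [m]. *)
Lemma inst_Leafs A m (p : tree A nat) : inst (map Leaf (iota 0 m)) p = p.
Proof.
rewrite -[RHS]graft_Leaf; apply: eq_in_graft => // j _.
have [ltj|lej] := ltnP j m.
  by rewrite (nth_map 0) ?size_iota // nth_iota // add0n.
by rewrite nth_default // size_map size_iota.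
Qed.

Lemma inst_ground A ts (p : tree A nat) : leaves p = [::] -> inst ts p = p.
Proof. by move=> p0; rewrite -[RHS]graft_Leaf; apply: eq_in_graft; rewrite // p0. Qed.

Lemma leaves_inst A (ts : seq (tree A nat)) p :
  perm_eq (leaves p) (iota 0 (size ts)) ->
  perm_eq (leaves (inst ts p)) (flatten (map (@leaves A nat) ts)).
Proof.
move=> pp; rewrite leaves_graft.
rewrite (perm_trans (perm_flatten (perm_map _ pp))) //.
by rewrite -[in X in perm_eq _ (flatten (map _ X))](map_nth_Leaf ts) -map_comp.
Qed.

Lemma labels_inst (A : eqType) (ts : seq (tree A nat)) p :
  perm_eq (leaves p) (iota 0 (size ts)) ->
  perm_eq (labels (inst ts p)) (labels p ++ flatten (map (@labels A nat) ts)).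
Proof.
move=> pp; rewrite (perm_trans (labels_graft _ _)) // perm_cat2l.
rewrite (perm_trans (perm_flatten (perm_map _ pp))) //.
by rewrite -[in X in perm_eq _ (flatten (map _ X))](map_nth_Leaf ts) -map_comp.
Qed.

Lemma leaf_lt_rank A (p : tree A nat) m j :
  perm_eq (leaves p) (iota 0 m) -> j \in leaves p -> j < m.
Proof. by move=> /perm_mem ->; rewrite mem_iota. Qed.

Lemma ranked_inst A (rnk : A -> nat) ts (p : tree A nat) :
  ranked rnk p -> all (ranked rnk) ts -> ranked rnk (inst ts p).
Proof.
move=> rp /allP rts; apply: ranked_graft => // j _.
have [ltj|lej] := ltnP j (size ts); first exact/rts/mem_nth.
by rewrite nth_default.
Qed.

Lemma gsubst_corolla A B (f : A -> tree B nat) a m :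
  gsubst f (corolla a m) = f a.
Proof. by rewrite /= -map_comp inst_Leafs. Qed.

Lemma eq_in_gsubst (A : eqType) B (f g : A -> tree B nat) t :
  {in labels t, f =1 g} -> gsubst f t = gsubst g t.
Proof.
elim/tree_nested_ind: t => //= a ts IH fg; rewrite fg ?mem_head //.
congr inst; apply/eq_in_map => t tts; apply: IH => // b bt; apply: fg.
by rewrite inE; apply/orP; right; apply/flattenP; exists (labels t) => //; apply: map_f.
Qed.

Section RankedSubst.
Variables (A B : eqType) (rA : A -> nat) (rB : B -> nat).

Definition pattern_map (f : A -> tree B nat) (L : seq A) :=
  {in L, forall a, pattern rB (rA a) (f a)}.

Lemma mem_labels_child (a b : A) ts (t : tree A nat) :
  t \in ts -> b \in labels t -> b \in labels (Node a ts).
Proof.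
move=> tts bt; rewrite inE; apply/orP; right.
by apply/flattenP; exists (labels t) => //; apply: map_f.
Qed.

Lemma gsubst_inst (C : Type) (f : A -> tree C nat) ts p :
  ranked rA p ->
  {in labels p, forall a, perm_eq (leaves (f a)) (iota 0 (rA a))} ->
  gsubst f (inst ts p) = inst (map (gsubst f) ts) (gsubst f p).
Proof.
elim/tree_nested_ind: p => [j|a us IH] /=.
  move=> _ _; rewrite /inst /=; have [ltj|lej] := ltnP j (size ts).
    by rewrite (nth_map (Leaf j)).
  by rewrite !nth_default ?size_map.
move=> /andP[/eqP sz /allP rus] pf.
rewrite {2}/inst graft_graft; apply: eq_in_graft => j.
move/(leaf_lt_rank (pf a (mem_head _ _))); rewrite -sz => ltj.
rewrite !(nth_map (Leaf j)) ?size_map //; apply: IH; rewrite ?mem_nth //.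
  exact/rus/mem_nth.
by move=> b bu; apply: pf; apply: mem_labels_child bu; apply: mem_nth.
Qed.

Lemma gsubst_pattern (f : A -> tree B nat) t :
  ranked rA t -> pattern_map f (labels t) ->
  [/\ ranked rB (gsubst f t), perm_eq (leaves (gsubst f t)) (leaves t)
    & perm_eq (labels (gsubst f t)) (flatten (map (fun a => labels (f a)) (labels t)))].
Proof.
elim/tree_nested_ind: t => [//|a ts IH] /= /andP[/eqP sz rts] pf.
have {}IH : {in ts, forall t, [/\ ranked rB (gsubst f t),
    perm_eq (leaves (gsubst f t)) (leaves t)
    & perm_eq (labels (gsubst f t)) (flatten (map (fun a => labels (f a)) (labels t)))]}.
  move=> t tts; apply: IH => //; first exact: (allP rts).
  by move=> b bt; apply: pf; apply: mem_labels_child bt.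
have /andP[ra pa] := pf a (mem_head _ _).
have pa' : perm_eq (leaves (f a)) (iota 0 (size (map (gsubst f) ts))).
  by rewrite size_map sz.
split.
- by apply: ranked_inst => //; rewrite all_map; apply/allP => t /IH[].
- rewrite (perm_trans (leaves_inst pa')) //; elim: ts IH {sz rts pf pa'} => //= t ts IHts IH.
  apply: perm_cat; first by case: (IH t (mem_head _ _)).
  by apply: IHts => u uts; apply: IH; rewrite inE uts orbT.
rewrite (perm_trans (labels_inst pa')) // perm_cat2l.
elim: ts IH {sz rts pf pa'} => //= t ts IHts IH.
rewrite map_cat flatten_cat; apply: perm_cat; first by case: (IH t (mem_head _ _)).
by apply: IHts => u uts; apply: IH; rewrite inE uts orbT.
Qed.

End RankedSubst.

(** Associativity of second-order substitution: a right-hand side may be filled in two stages, first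
    with skeletons and then with pieces. *)
Lemma gsubst_gsubst (A B : eqType) (C : Type) (rB : B -> nat)
    (f : A -> tree B nat) (g : B -> tree C nat) t :
  {in labels t, forall a, ranked rB (f a) /\ {in labels (f a), forall b,
     perm_eq (leaves (g b)) (iota 0 (rB b))}} ->
  gsubst g (gsubst f t) = gsubst (fun a => gsubst g (f a)) t.
Proof.
elim/tree_nested_ind: t => //= a ts IH H.
have [rfa pg] := H a (mem_head _ _).
rewrite (gsubst_inst _ rfa pg) -map_comp; congr inst; apply/eq_in_map => t tts.
by apply: IH => // b bt; apply: H; apply: mem_labels_child bt.
Qed.

Lemma gsubst_lmap A B C (g : B -> tree C nat) (f : A -> B) t :
  gsubst g (lmap f t) = gsubst (g \o f) t.
Proof.
elim/tree_nested_ind: t => //= a ts IH; congr inst; rewrite -map_comp.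
exact/eq_in_map.
Qed.

(** * Decomposition into footed patterns *)

(* The decomposition of a pattern is a tree labelled with footed patterns.  A
   node is absorbed by its only child that contains a variable, unless that
   child is a variable. *)

Definition root_label A (d : tree (tree A nat) nat) : tree A nat :=
  if d is Node p _ then p else Leaf 0.

Definition children A X (d : tree A X) : seq (tree A X) :=
  if d is Node _ ds then ds else [::].

Definition is_node A X (d : tree A X) : bool := if d is Node _ _ then true else false.

Definition ground A X (t : tree A X) : bool := nilp (leaves t).

(** Also true if no child contains a variable, so that a ground tree collapses to a single piece.
    Demanding nodes keeps the parent of a variable as a foot, and keeps the default of [root_label]
    out of reach. *)
Definition merges A X (ds : seq (tree A X)) : bool :=
  all (@is_node A X) ds && (count (predC (@ground A X)) ds <= 1).

Definition dec_node A (p : tree A nat) (ds : seq (tree (tree A nat) nat)) :=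
  if merges ds then
    Node (inst (map (@root_label A) ds) p) (flatten (map (@children _ _) ds))
  else Node p ds.

Fixpoint dec A (t : tree A nat) : tree (tree A nat) nat :=
  match t with
  | Leaf j => Leaf j
  | Node a ts => dec_node (corolla a (size ts)) (map (@dec A) ts)
  end.

(** Footedness as a path: beside the way from the root down to the foot everything is ground. This
    form fixes the order of the variables and allows induction along the path. *)
Inductive foot A (rnk : A -> nat) : nat -> tree A nat -> Prop :=
  | Foot_here a : foot rnk (rnk a) (corolla a (rnk a))
  | Foot_ground t : leaves t = [::] -> foot rnk 0 t
  | Foot_above a m ts1 t ts2 :
      all (@ground A nat) ts1 -> all (@ground A nat) ts2 -> foot rnk m t ->
      foot rnk m (Node a (ts1 ++ t :: ts2)).

Lemma ground_flatten A X (ts : seq (tree A X)) :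
  nilp (flatten (map (@leaves A X) ts)) = all (@ground A X) ts.
Proof. by elim: ts => //= t ts <-; rewrite /ground /nilp size_cat addn_eq0. Qed.

Lemma groundP A X (t : tree A X) : reflect (leaves t = [::]) (ground t).
Proof. exact: nilP. Qed.

Lemma ground_node A X (t : tree A X) : ground t -> is_node t.
Proof. by case: t. Qed.

Lemma ground_lmap A B X (f : A -> B) (t : tree A X) : ground (lmap f t) = ground t.
Proof. by rewrite /ground leaves_lmap. Qed.

Lemma leaves_dec A (t : tree A nat) : leaves (dec t) = leaves t.
Proof.
elim/tree_nested_ind: t => //= a ts IH.
have {IH} <- : flatten (map (@leaves _ _) (map (@dec A) ts)) = flatten (map (@leaves _ _) ts).
  by rewrite -map_comp; congr flatten; apply/eq_in_map.
rewrite /dec_node; case: ifP => //= /andP[nds _].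
elim: (map _ ts) nds => //= -[//|p ps] ds IH /= /IH <-.
by rewrite map_cat flatten_cat.
Qed.

Lemma ground_dec A (t : tree A nat) : ground (dec t) = ground t.
Proof. by rewrite /ground leaves_dec. Qed.

Lemma is_node_dec A (t : tree A nat) : is_node (dec t) = is_node t.
Proof. by case: t => //= a ts; rewrite /dec_node; case: ifP. Qed.

Lemma merges_dec A (ts : seq (tree A nat)) : merges (map (@dec A) ts) = merges ts.
Proof.
rewrite /merges all_map (eq_all (@is_node_dec A)) count_map; congr (_ && (_ <= 1)).
by apply: eq_count => t /=; rewrite ground_dec.
Qed.

Lemma dec_ground A (t : tree A nat) : ground t -> dec t = Node t [::].
Proof.
elim/tree_nested_ind: t => //= a ts IH.
rewrite /ground /= ground_flatten => /allP gts.
have -> : map (@dec A) ts = map (fun t => Node t [::]) ts.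
  by apply/eq_in_map => t tts; apply: IH => //; apply: gts.
rewrite /dec_node; have -> : merges (map (fun t : tree A nat => Node t [::]) ts :
                    seq (tree (tree A nat) nat)) by elim: ts {IH gts}.
rewrite -!map_comp map_id inst_corolla; congr Node.
by elim: ts {IH gts}.
Qed.

Lemma merges_split A (ts : seq (tree A nat)) :
  merges ts -> ~~ all (@ground A nat) ts ->
  exists ts1 a us ts2, [/\ ts = ts1 ++ Node a us :: ts2, all (@ground A nat) ts1
    , all (@ground A nat) ts2 & ~~ ground (Node a us)].
Proof.
move=> /andP[nts cts]; rewrite -has_predC => hts.
case/split_find: hts nts cts => t ts1 ts2 nt; rewrite -all_predC => gts1.
rewrite !all_cat all_rcons /= => /andP[/andP[ntn _] _].
rewrite /= in nt; rewrite -cats1 !count_cat /= nt => cts.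
case: t nt ntn cts => // a us nt _ cts.
exists ts1, a, us, ts2; split=> //; first by rewrite -catA.
  by apply: sub_all gts1 => u /=; rewrite negbK.
have : count (predC (@ground A nat)) ts2 == 0 by lia.
by rewrite -leqn0 leqNgt -has_count has_predC negbK.
Qed.

Lemma all_flatten T (P : pred T) (ss : seq (seq T)) :
  all P (flatten ss) = all (all P) ss.
Proof. by elim: ss => //= s ss <-; rewrite all_cat. Qed.

(** The ground case is separated from absorption, so that in [Dec_absorb] exactly one child contains
    variables and hands its top piece to the parent. *)
Variant dec_spec A (a : A) (ts : seq (tree A nat)) :
    tree (tree A nat) nat -> Prop :=
  | Dec_ground of ground (Node a ts) : dec_spec a ts (Node (Node a ts) [::])
  | Dec_absorb ts1 b us ts2 q qs of
      ts = ts1 ++ Node b us :: ts2 & all (@ground A nat) ts1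
      & all (@ground A nat) ts2
      & ~~ ground (Node b us) & dec (Node b us) = Node q qs :
      dec_spec a ts (Node (Node a (ts1 ++ q :: ts2)) qs)
  | Dec_branch of ~~ merges ts :
      dec_spec a ts (Node (corolla a (size ts)) (map (@dec A) ts)).

Lemma map_dec_ground A (ts : seq (tree A nat)) :
  all (@ground A nat) ts -> map (@dec A) ts = map (fun t => Node t [::]) ts.
Proof. by move=> /allP gts; apply/eq_in_map => t /gts/dec_ground. Qed.

Lemma map_root_ground A (ts : seq (tree A nat)) :
  all (@ground A nat) ts -> map (@root_label A) (map (@dec A) ts) = ts.
Proof. by move=> /map_dec_ground ->; rewrite -map_comp map_id. Qed.

Lemma children_ground A (ts : seq (tree A nat)) :
  all (@ground A nat) ts -> flatten (map (@children _ _) (map (@dec A) ts)) = [::].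
Proof. by move=> /map_dec_ground ->; elim: ts. Qed.

Lemma merges_absorb A X (ts1 : seq (tree A X)) t ts2 :
  all (@ground A X) ts1 -> all (@ground A X) ts2 -> is_node t ->
  merges (ts1 ++ t :: ts2).
Proof.
move=> g1 g2 nt; rewrite /merges all_cat /= nt.
have gn := sub_all (@ground_node A X); rewrite !gn //=.
have c0 ts : all (@ground A X) ts -> count (predC (@ground A X)) ts = 0.
  by rewrite -[all _ _]negbK -has_predC has_count; lia.
by rewrite count_cat /= !c0 //; case: (ground t).
Qed.

Lemma dec_node_absorb A (a : A) ts1 t ts2 :
  all (@ground A nat) ts1 -> all (@ground A nat) ts2 -> is_node t ->
  dec (Node a (ts1 ++ t :: ts2)) =
  Node (Node a (ts1 ++ root_label (dec t) :: ts2)) (children (dec t)).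
Proof.
move=> g1 g2 nt; rewrite /= /dec_node merges_dec merges_absorb //.
rewrite -[size _](size_map (@root_label A \o @dec A)) map_comp inst_corolla.
by rewrite !map_cat /= flatten_cat /= !map_root_ground // !children_ground // cats0.
Qed.

Lemma decP A (a : A) ts : dec_spec a ts (dec (Node a ts)).
Proof.
have [g|ng] := boolP (ground (Node a ts)); first by rewrite dec_ground //; constructor.
have [m|nm] := boolP (merges ts); last first.
  by rewrite /= /dec_node merges_dec (negbTE nm); constructor.
rewrite /ground /= ground_flatten in ng.
have [ts1 [b [us [ts2 [-> g1 g2 gb]]]]] := merges_split m ng.
rewrite dec_node_absorb //; have := is_node_dec (Node b us).
case E: dec => [//|q qs] _; exact: (Dec_absorb _ _ g1 g2 gb E).
Qed.

Lemma foot_leaves A (rnk : A -> nat) m p : foot rnk m p -> leaves p = iota 0 m.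
Proof.
elim=> [a|t ->|a {}m ts1 t ts2 g1 g2 _ IH] //.
  by rewrite /= -map_comp; elim: (iota _ _) => //= i s ->.
rewrite /= map_cat flatten_cat /= IH; move: g1 g2.
by rewrite -!ground_flatten => /nilP -> /nilP ->; rewrite cats0.
Qed.

(** Each node strictly above the foot has at most one child that is not ground, and that child is a
    node; so it is absorbed, and only the foot decides whether to merge. *)
Lemma dec_inst A (rnk : A -> nat) p ts :
  foot rnk (size ts) p -> dec (inst ts p) = dec_node p (map (@dec A) ts).
Proof.
move E: (size ts) => m fp; elim: fp E => {m p} [a|p p0|a m ts1 t ts2 g1 g2 ft IH] E.
- by rewrite -E inst_corolla.
- case: ts E => // _; rewrite /dec_node /merges /= !inst_ground //.
  by apply: dec_ground; apply/groundP.
have t_node : is_node t by case: {IH} ft => // u u0; apply: ground_node; apply/groundP.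
have inst_ctx us : inst us (Node a (ts1 ++ t :: ts2)) = Node a (ts1 ++ inst us t :: ts2).
  rewrite /inst /= map_cat /=; congr (Node a (_ ++ _ :: _)).
    by rewrite -[RHS]map_id; apply/eq_in_map => u /(allP g1)/groundP; apply: inst_ground.
  by rewrite -[RHS]map_id; apply/eq_in_map => u /(allP g2)/groundP; apply: inst_ground.
rewrite inst_ctx dec_node_absorb //; last by case: (t) t_node.
by rewrite IH // /dec_node; case: ifP; rewrite /= ?inst_ctx.
Qed.

Lemma merges_lmap A B X (f : A -> B) (ds : seq (tree A X)) :
  merges (map (lmap f) ds) = merges ds.
Proof.
rewrite /merges all_map count_map; congr (_ && (_ <= 1)).
  by apply: eq_all => -[].
by apply: eq_count => d /=; rewrite ground_lmap.
Qed.

(** By [dec_inst] the instance of [g a] behaves like a single node, and the test [merges] sees only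
    leaves and groundness, which substitution does not change. *)
Lemma dec_gsubst (A : eqType) B (rA : A -> nat) (rB : B -> nat)
    (g : A -> tree B nat) t :
  ranked rA t -> {in labels t, forall a, foot rB (rA a) (g a)} ->
  dec (gsubst g t) = lmap (gsubst g) (dec t).
Proof.
elim/tree_nested_ind: t => // a ts IH /= /andP[/eqP sz rts] fg.
rewrite (@dec_inst _ rB); last by rewrite size_map sz; apply/fg/mem_head.
have E : map (@dec B) (map (gsubst g) ts) = map (lmap (gsubst g)) (map (@dec A) ts).
  rewrite -!map_comp; apply/eq_in_map => t tts; apply: IH => //.
    exact: (allP rts).
  by move=> b bt; apply: fg; apply: mem_labels_child bt.
rewrite E {1}/dec_node merges_lmap /dec_node; case: ifP => [m|_]; last first.
  by rewrite -[in LHS](gsubst_corolla g a (size ts)).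
have E1 : map (@root_label B) (map (lmap (gsubst g)) (map (@dec A) ts)) =
    map (gsubst g) (map (@root_label A) (map (@dec A) ts)).
  move: m => /andP[/allP nds _]; rewrite -[in LHS]map_comp -[in RHS]map_comp.
  by apply/eq_in_map => d /nds; case: d.
have E2 : flatten (map (@children _ _) (map (lmap (gsubst g)) (map (@dec A) ts))) =
    map (lmap (gsubst g)) (flatten (map (@children _ _) (map (@dec A) ts))).
  rewrite map_flatten -!map_comp; congr flatten; apply/eq_map => t /=.
  by case: (dec t).
rewrite E1 E2 -[RHS]/(Node (gsubst g _) (map (lmap (gsubst g)) _)); congr Node.
rewrite -[size ts](size_map (@dec A)) -(size_map (@root_label A) (map (@dec A) ts)).
by rewrite inst_corolla.
Qed.

(** * Properties and number of the pieces *)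

Lemma mem_nodes_child (A : eqType) (x : A * nat) X a ts (t : tree A X) :
  t \in ts -> x \in nodes t -> x \in nodes (Node a ts).
Proof.
move=> tts bt; rewrite inE; apply/orP; right.
by apply/flattenP; exists (nodes t) => //; apply: map_f.
Qed.

Lemma mem_nodes_children (A : eqType) X (a : A) (ts : seq (tree A X)) x :
  x \in nodes (Node a ts) -> x = (a, size ts) \/ exists2 t, t \in ts & x \in nodes t.
Proof.
rewrite inE => /predU1P[->|/flattenP[_ /mapP[t tts ->] xt]]; first by left.
by right; exists t.
Qed.

Lemma dec_foot A (rnk : A -> nat) t :
  ranked rnk t -> {in nodes (dec t), forall x, foot rnk x.2 x.1}.
Proof.
elim/tree_nested_ind: t => // a ts IH; rewrite [ranked _ _]/= => /andP[/eqP sz /allP rts] x.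
case: (decP a ts) => [g|ts1 b us ts2 q qs E g1 g2 _ Ed|_].
- by case/mem_nodes_children => [->|[]//]; apply: Foot_ground; apply/groundP.
- have IHb : {in nodes (Node q qs), forall x, foot rnk x.2 x.1}.
    have bts : Node b us \in ts by rewrite E mem_cat mem_head orbT.
    by rewrite -Ed; apply: IH => //; apply: rts.
  case/mem_nodes_children => [->|[d dqs xd]].
    by apply: Foot_above => //; apply: (IHb (q, size qs)); rewrite mem_head.
  by apply: IHb; apply: mem_nodes_child xd.
case/mem_nodes_children => [->|[_ /mapP[t tts ->] xt]].
  by rewrite /= size_map sz; apply: Foot_here.
by apply: IH xt => //; apply: rts.
Qed.

Lemma dec_ranked A (rnk : A -> nat) t :
  ranked rnk t -> all (ranked rnk) (labels (dec t)).
Proof.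
elim/tree_nested_ind: t => // a ts IH; rewrite [ranked _ _]/= => /andP[sz rts].
have {}IH : {in ts, forall t, all (ranked rnk) (labels (dec t))}.
  by move=> t tts; apply: IH => //; apply: (allP rts).
have rcor : ranked rnk (corolla a (size ts)).
  by rewrite /= size_map size_iota sz /= all_map; apply/allP.
case: (decP a ts) => [g|ts1 b us ts2 q qs E g1 g2 _ Ed|_].
- by rewrite /= sz rts.
- have := IH (Node b us); rewrite {1}E mem_cat mem_head orbT => /(_ isT).
  rewrite Ed /= => /andP[rq rqs]; move: sz rts; rewrite E !size_cat /= => ->.
  by rewrite !all_cat /= => /and3P[-> _ ->]; rewrite rq rqs.
rewrite -[X in is_true X]/(ranked rnk (corolla a (size ts)) &&
  all (ranked rnk) (flatten (map (@labels _ _) (map (@dec A) ts)))) rcor /=.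
by rewrite all_flatten -!map_comp all_map; apply/allP.
Qed.

(** The labels of a decomposition are themselves patterns, so substituting each label for itself
    reassembles the tree. *)
Lemma gsubst_id_dec A (t : tree A nat) : gsubst id (dec t) = t.
Proof.
elim/tree_nested_ind: t => // a ts IH.
case: (decP a ts) => [g|ts1 b us ts2 q qs E g1 g2 _ Ed|_].
- by rewrite /= inst_ground //; apply/groundP.
- have := IH (Node b us); rewrite {1}E mem_cat mem_head orbT => /(_ isT).
  rewrite Ed /= E => Eq; rewrite /inst /= map_cat /= [graft _ q]Eq.
  congr (Node a (_ ++ _ :: _)).
    by rewrite -[RHS]map_id; apply/eq_in_map => u /(allP g1)/groundP; apply: inst_ground.
  by rewrite -[RHS]map_id; apply/eq_in_map => u /(allP g2)/groundP; apply: inst_ground.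
rewrite /= -map_comp (_ : map _ ts = ts) ?inst_corolla //.
by rewrite -[RHS]map_id; apply/eq_in_map.
Qed.

Lemma labels_dec (A : eqType) (t : tree A nat) :
  perm_eq (flatten (map (@labels A nat) (labels (dec t)))) (labels t).
Proof.
elim/tree_nested_ind: t => // a ts IH.
case: (decP a ts) => [g|ts1 b us ts2 q qs E g1 g2 _ Ed|_].
- by rewrite /= cats0.
- have := IH (Node b us); rewrite {1}E mem_cat mem_head orbT => /(_ isT).
  rewrite Ed => /permP Eb; apply/permP => P; move: (Eb P); rewrite E /=.
  by rewrite !map_cat !flatten_cat /= !count_cat /= ?count_cat; lia.
have lc : labels (corolla a (size ts)) = [:: a].
  by rewrite /= -map_comp; congr cons; elim: (iota _ _).
rewrite -[flatten _]/(labels (corolla a (size ts)) ++ flatten (map (@labels _ _)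
  (flatten (map (@labels _ _) (map (@dec A) ts))))) lc perm_cons .
elim: ts IH {lc} => //= t ts IHts IH.
rewrite map_cat flatten_cat; apply: perm_cat; first exact/IH/mem_head.
by apply: IHts => u uts; apply: IH; rewrite inE uts orbT.
Qed.

Lemma dec_arities A (r : nat) (t : tree A nat) :
  all (fun m => m <= r) (arities t) -> all (fun m => m <= r) (arities (dec t)).
Proof.
elim/tree_nested_ind: t => // a ts IH; rewrite arities_node [all _ _]/= => /andP[sz].
rewrite all_flatten all_map => /allP rts.
case: (decP a ts) => [g|ts1 b us ts2 q qs E g1 g2 _ Ed|_] //.
  have bts : Node b us \in ts by rewrite E mem_cat mem_head orbT.
  by have := IH _ bts (rts _ bts); rewrite Ed !arities_node.
rewrite arities_node [all _ _]/= size_map sz all_flatten -map_comp all_map.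
by apply/allP => t tts; apply: (IH t tts (rts t tts)).
Qed.

(** With [l] variables this says at most [r * (2 * l - 1)] pieces; the summand [r] on the left is
    the slack that the induction at a branching consumes. *)
Lemma size_dec A (r : nat) (t : tree A nat) :
  0 < r -> all (fun m => m <= r) (arities t) -> ~~ ground t ->
  size (nodes (dec t)) + r <= 2 * r * size (leaves t).
Proof.
move=> r0; elim/tree_nested_ind: t => [j|a ts IH].
  by rewrite /=; lia.
rewrite arities_node [all _ _]/= => /andP[sz].
rewrite all_flatten all_map => /allP rts.
case: (decP a ts) => [->//|ts1 b us ts2 q qs E g1 g2 gb Ed _|nm _].
  have bts : Node b us \in ts by rewrite E mem_cat mem_head orbT.
  have := IH _ bts (rts _ bts) gb; rewrite Ed [nodes _]/= [nodes _]/=.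
  rewrite [leaves _]/= [leaves (Node a _)]/= E map_cat flatten_cat /=.
  by move: g1 g2; rewrite -!ground_flatten => /nilP -> /nilP ->; rewrite cats0.
(* A child that is a variable has no piece at all, which leaves a second slack of [r]. *)
have {}IH : {in ts, forall t, ~~ ground t ->
    size (nodes (dec t)) + r + r * ~~ is_node t <= 2 * r * size (leaves t)}.
  move=> t tts gt; case: t tts gt (IH t tts (rts t tts)) => [j|b us] tts gt IHt.
    by rewrite /=; lia.
  by have := IHt gt; rewrite [is_node _]/=; lia.
(* Summing over the children: each ground one contributes one piece, each other one a credit of [r],
   and each variable a further [r]. Counting the ground children as all minus the others turns [r]
   into [r + 1]. *)
have sum_le : size (flatten (map (@nodes _ _) (map (@dec A) ts)))
    + (r + 1) * count (predC (@ground A nat)) ts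
    + r * count (predC (@is_node A nat)) ts
    <= size ts + 2 * r * size (flatten (map (@leaves A nat) ts)).
  elim: ts {sz rts nm} IH => [|t ts IHts] IH; first by rewrite /=; lia.
  have {}IHts := IHts (fun u uts => IH u (mem_behead (s := t :: ts) uts)).
  rewrite /= !size_cat; have [gt|ngt] := boolP (ground t).
    by rewrite dec_ground // (groundP _ gt) ground_node //= ; lia.
  have aux n k l s c d z L : n + r + r * k <= 2 * r * l ->
      s + (r + 1) * c + r * d <= z + 2 * r * L ->
      n + s + (r + 1) * (1 + c) + r * (k + d) <= z.+1 + 2 * r * (l + L) by lia.
  exact: aux (IH t (mem_head _ _) ngt) IHts.
have nodes_ground : count (predC (@is_node A nat)) ts <= count (predC (@ground A nat)) ts.
  by apply: sub_count => u /=; apply: contra; apply: ground_node.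
have big2 : 1 <= count (predC (@ground A nat)) ts.
  move: nm; rewrite negb_and -has_predC has_count; lia.
have nm' : (1 <= count (predC (@is_node A nat)) ts) || (2 <= count (predC (@ground A nat)) ts).
  by move: nm; rewrite negb_and -has_predC has_count; lia.
rewrite [nodes _]/= [leaves _]/= size_map /= in sum_le *.
(* Either way the credit is at least [2 * r + 1]: it pays for the node itself, for its at most [r]
   children, and for the slack [r] of the claim. *)
case/orP: nm' => h; nia.
Qed.

Lemma size_dec_ground A (t : tree A nat) : ground t -> size (nodes (dec t)) = 1.
Proof. by move=> g; rewrite dec_ground. Qed.

(** * Skeletons *)

Section Fill.
Variables (A X : Type).

(** Labels are handed out in preorder, each child taking as many as it has nodes. The inner loop is
    a copy of [fills] that keeps the recursion structural. *)
Fixpoint fill (B : Type) (b0 : B) (ls : seq B) (t : tree A X) : tree B X :=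
  match t with
  | Leaf x => Leaf x
  | Node _ ts =>
      Node (head b0 ls)
        ((fix fills (ls : seq B) (ts : seq (tree A X)) : seq (tree B X) :=
            if ts is t :: ts' then
              fill b0 (take (size (nodes t)) ls) t :: fills (drop (size (nodes t)) ls) ts'
            else [::]) (behead ls) ts)
  end.

Fixpoint fills (B : Type) (b0 : B) (ls : seq B) (ts : seq (tree A X)) : seq (tree B X) :=
  if ts is t :: ts' then
    fill b0 (take (size (nodes t)) ls) t :: fills b0 (drop (size (nodes t)) ls) ts'
  else [::].

Lemma fill_node (B : Type) (b0 : B) ls a ts :
  fill b0 ls (Node a ts) = Node (head b0 ls) (fills b0 (behead ls) ts).
Proof. by rewrite /=; congr Node; elim: ts (behead ls) => //= t ts IH ls'; rewrite IH. Qed.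

Lemma fill_ind (P : forall B : Type, B -> seq B -> tree A X -> Prop)
    (Q : forall B : Type, B -> seq B -> seq (tree A X) -> Prop) :
  (forall B (b0 : B) ls x, P B b0 ls (Leaf x)) ->
  (forall B (b0 : B) ls a ts, Q B b0 (behead ls) ts -> P B b0 ls (Node a ts)) ->
  (forall B (b0 : B) ls, Q B b0 ls [::]) ->
  (forall B (b0 : B) ls t ts, P B b0 (take (size (nodes t)) ls) t ->
     Q B b0 (drop (size (nodes t)) ls) ts -> Q B b0 ls (t :: ts)) ->
  (forall B (b0 : B) ls t, P B b0 ls t) /\ (forall B (b0 : B) ls ts, Q B b0 ls ts).
Proof.
move=> PL PN Q0 QS; have HP : forall t B (b0 : B) ls, P B b0 ls t.
  elim/tree_nested_ind => [x|a ts IH] B b0 ls; first exact: PL.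
  apply: PN; elim: ts (behead ls) IH => [|t ts IHts] ls' IH; first exact: Q0.
  apply: QS; first exact/IH/mem_head.
  by apply: IHts => u uts; apply: IH; rewrite inE uts orbT.
split=> // B b0 ls ts; elim: ts ls => [|t ts IH] ls; first exact: Q0.
by apply: QS.
Qed.

End Fill.

(** Shape and preorder labels determine a tree; hence skeletons and pieces together determine a
    decomposition. *)
Lemma fills_labels A B X (b0 : B) (f : B -> A) (ds : seq (tree B X)) :
  fills b0 (flatten (map (@labels B X) ds)) (map (lmap f) ds) = ds.
Proof.
have nodes_lmap (d : tree B X) : size (nodes (lmap f d)) = size (labels d).
  by rewrite -size_labels labels_lmap size_map.
have fillE (d : tree B X) : fill b0 (labels d) (lmap f d) = d.
  elim/tree_nested_ind: d => // b us IH; rewrite [lmap _ _]/= fill_node /=.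
  congr Node; elim: us IH => //= u us IHus IH.
  rewrite nodes_lmap take_size_cat // drop_size_cat // IH ?mem_head //.
  by congr cons; apply: IHus => v vus; apply: IH; rewrite inE vus orbT.
elim: ds => //= d ds IH.
by rewrite nodes_lmap take_size_cat // drop_size_cat // fillE IH.
Qed.

Lemma map_lmap_fills A B C X (g : B -> C) (b0 : B) ls (ts : seq (tree A X)) :
  map (lmap g) (fills b0 ls ts) = fills (g b0) (map g ls) ts.
Proof.
have [||||_] := @fill_ind A X
  (fun B' b0 ls t => forall C (g : B' -> C), lmap g (fill b0 ls t) = fill (g b0) (map g ls) t)
  (fun B' b0 ls ts => forall C (g : B' -> C),
     map (lmap g) (fills b0 ls ts) = fills (g b0) (map g ls) ts).
- by [].
- move=> {}B {}b0 {}ls a {}ts IH {}C {}g; rewrite !fill_node /= IH behead_map; congr Node.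
  by case: ls {IH}.
- by [].
- by move=> {}B {}b0 {}ls t {}ts IH1 IH2 {}C {}g; rewrite /= IH1 IH2 map_take map_drop.
exact.
Qed.

(** The condition on [f] says that the labels of [ts] carry no information, as in a skeleton, so
    erasing the new labels gives [ts] back. *)
Lemma fills_spec A B X (f : B -> A) (b0 : B) ls (ts : seq (tree A X)) :
  (forall a b, f b = a) ->
  size ls = size (flatten (map (@nodes A X) ts)) ->
  flatten (map (@labels B X) (fills b0 ls ts)) = ls /\ map (lmap f) (fills b0 ls ts) = ts.
Proof.
move=> fa; have [||||_] := @fill_ind A X
  (fun B b0 ls t => forall f : B -> A, (forall a b, f b = a) -> size ls = size (nodes t) ->
     labels (fill b0 ls t) = ls /\ lmap f (fill b0 ls t) = t)
  (fun B b0 ls ts => forall f : B -> A, (forall a b, f b = a) ->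
     size ls = size (flatten (map (@nodes A X) ts)) ->
     flatten (map (@labels B X) (fills b0 ls ts)) = ls /\ map (lmap f) (fills b0 ls ts) = ts).
- by move=> {f fa ls}B {}b0 ls x f fa /size0nil ->.
- move=> {f fa ls}B {}b0 [|l ls] a {}ts IH f fa; rewrite ?fill_node //= => -[sz]; move: (IH f fa sz) => /= [E1 E2].
  by rewrite E1 E2 (fa a).
- by move=> {f fa ls}B {}b0 ls f fa /size0nil ->.
- move=> {f fa ls}B {}b0 ls t {}ts IH1 IH2 f fa; rewrite [flatten _]/= size_cat => sz.
  have [|E1 E2] := IH1 f fa; first by rewrite size_takel // sz leq_addr.
  have [|E3 E4] := IH2 f fa; first by rewrite size_drop sz addKn.
  by rewrite /= E1 E2 E3 E4 cat_take_drop.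
by apply.
Qed.

Section Skeletons.

Definition shape A X (t : tree A X) : tree unit X := lmap (fun _ => tt) t.

Definition skeletons A (w : seq (tree A nat)) : seq (tree unit nat) :=
  map (fun t => shape (dec t)) w.

Definition pieces A (w : seq (tree A nat)) : seq (tree A nat) :=
  flatten (map (fun t => labels (dec t)) w).

Definition forest_arities A X (ts : seq (tree A X)) : seq nat :=
  flatten (map (@arities A X) ts).

Lemma shape_lmap A B X (f : A -> B) (t : tree A X) : shape (lmap f t) = shape t.
Proof. exact: lmap_comp. Qed.

Lemma forest_arities_skeletons A (w : seq (tree A nat)) :
  forest_arities (skeletons w) = forest_arities (map (@dec A) w).
Proof.
rewrite /forest_arities -!map_comp; congr flatten; apply/eq_map => t /=.
exact: arities_lmap.
Qed.

Lemma size_pieces A (w : seq (tree A nat)) :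
  size (pieces w) = size (forest_arities (skeletons w)).
Proof.
rewrite forest_arities_skeletons /pieces /forest_arities.
elim: w => //= t w IH; rewrite !size_cat IH; congr addn.
by rewrite size_labels size_map.
Qed.

Lemma zip_pieces A (w : seq (tree A nat)) :
  zip (pieces w) (forest_arities (skeletons w)) =
  flatten (map (fun t => nodes (dec t)) w).
Proof.
rewrite forest_arities_skeletons /pieces /forest_arities.
elim: w => //= t w IH; rewrite zip_cat; last by rewrite size_labels size_map.
by rewrite IH -unzip1_nodes zip_unzip.
Qed.

Lemma ranked_arities A X (rnk : A -> nat) (t : tree A X) :
  arities t = map rnk (labels t) -> ranked rnk t.
Proof.
elim/tree_nested_ind: t => // a ts IH; rewrite arities_node /= => -[-> E].
rewrite eqxx; apply/allP; elim: ts IH E => // t ts IHts IH /=.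
rewrite map_cat => /eqP; rewrite eqseq_cat; last first.
  by rewrite !size_map size_labels.
case/andP => /eqP Et /eqP Ets u; rewrite inE => /predU1P[->|uts].
  by apply: IH Et; rewrite mem_head.
by apply: IHts uts => // v vts; apply: IH; rewrite inE vts orbT.
Qed.

Lemma arities_ranked A X (rnk : A -> nat) (t : tree A X) :
  ranked rnk t -> arities t = map rnk (labels t).
Proof.
elim/tree_nested_ind: t => // a ts IH; rewrite arities_node /= => /andP[/eqP -> /allP rts].
by congr cons; rewrite map_flatten -map_comp; congr flatten; apply/eq_in_map => t tts;
  apply: IH => //; apply: rts.
Qed.

Lemma forest_ranked_arities A X (rnk : A -> nat) (ts : seq (tree A X)) :
  forest_arities ts = map rnk (flatten (map (@labels A X) ts)) -> all (ranked rnk) ts.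
Proof.
elim: ts => //= t ts IH; rewrite /forest_arities /= map_cat => /eqP.
rewrite eqseq_cat; last by rewrite !size_map size_labels.
by case/andP => /eqP/ranked_arities -> /eqP.
Qed.

(** * Finiteness of the set of bounded skeletons *)

Fixpoint seqs_upto T (l : seq T) n : seq (seq T) :=
  if n is n'.+1 then [::] :: [seq x :: s | x <- l, s <- seqs_upto l n']
  else [:: [::]].

Lemma mem_seqs_upto (T : eqType) (l : seq T) n s :
  size s <= n -> {subset s <= l} -> s \in seqs_upto l n.
Proof.
elim: n s => [|n IH] [|x s] //= szs sl.
rewrite inE; apply/allpairsP; exists (x, s); split=> //=.
  by apply: sl; rewrite mem_head.
by apply: IH => // y ys; apply: sl; rewrite inE ys orbT.
Qed.

Fixpoint small_trees r k n : seq (tree unit nat) :=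
  map Leaf (iota 0 k) ++
  if n is n'.+1 then map (Node tt) (seqs_upto (small_trees r k n') r) else [::].

Lemma mem_small_trees r k n (s : tree unit nat) :
  all (fun m => m <= r) (arities s) -> {in leaves s, forall j, j < k} ->
  size (arities s) <= n -> s \in small_trees r k n.
Proof.
elim/tree_nested_ind: s n => [j|[] ts IH] n.
  move=> _ /(_ j (mem_head _ _)) jk _; case: n => [|n]; rewrite /= mem_cat;
  by apply/orP; left; apply: map_f; rewrite mem_iota.
rewrite arities_node; case: n => // n /= /andP[sz ar] lv szn.
rewrite mem_cat; apply/orP; right; apply/map_f/mem_seqs_upto => // t tts.
have artf : {subset arities t <= flatten (map (@arities _ _) ts)}.
  by move=> m mt; apply/flattenP; exists (arities t) => //; apply: map_f.
apply: IH => //.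
- by apply/allP => m /artf; apply: (allP ar).
- by move=> j jt; apply: lv; apply/flattenP; exists (leaves t) => //; apply: map_f.
rewrite ltnS in szn; apply: leq_trans szn; elim: ts tts {sz ar lv artf} => // u ts IH.
by rewrite inE /= size_cat => /predU1P[->|/IH]; lia.
Qed.

End Skeletons.

(** * Lookup in concatenated blocks *)

Lemma all2_mapr (T : Type) U (P : T -> U -> bool) f s :
  all2 P s (map f s) = all (fun x => P x (f x)) s.
Proof. by elim: s => //= x s ->. Qed.

(** [forest_subst] finds the value of a name by its position in the concatenated blocks; as no name
    is repeated, each block recovers exactly its own values. *)
Lemma map_index_flatten (T K : eqType) U (d : U) (ks : seq K)
    (A : K -> seq T) (W : K -> seq U) :
  uniq (flatten (map A ks)) -> {in ks, forall k, size (A k) = size (W k)} ->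
  {in ks, forall k,
     map (fun x => nth d (flatten (map W ks)) (index x (flatten (map A ks)))) (A k) = W k}.
Proof.
elim: ks => //= k0 ks IH; rewrite cat_uniq => /and3P[u0 disj uks] sz k.
have sz0 := sz k0 (mem_head _ _).
rewrite inE; case: eqP => [-> _|_ /= kks].
  apply: (@eq_from_nth _ d); rewrite size_map // => i lti.
  case E: (A k0) lti => [//|x0 s0] lti; rewrite -E in lti *.
  rewrite (nth_map x0) // index_cat mem_nth // index_uniq // nth_cat -sz0 lti //.
rewrite -[RHS](IH uks) //; last by move=> j jks; apply: sz; rewrite inE jks orbT.
apply/eq_in_map => x xk; rewrite index_cat ifN.
  by rewrite nth_cat -sz0 ltnNge leq_addr /= addKn.
apply/negP => xk0; case/hasP: disj; exists x => //.
by apply/flattenP; exists (A k) => //; apply: map_f.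
Qed.

Lemma uniq_flatten (T : finType) (ss : seq (seq T)) :
  uniq ss -> {in ss, forall s, uniq s} ->
  {in ss &, forall s s', s != s' -> [disjoint [set:: s] & [set:: s']]} ->
  uniq (flatten ss).
Proof.
elim: ss => //= s ss IH /andP[sss uss] us dss; rewrite cat_uniq us ?mem_head //=.
rewrite IH //; first last.
- by move=> t t' tss t'ss; apply: dss; rewrite inE ?tss ?t'ss orbT.
- by move=> t tss; apply: us; rewrite inE tss orbT.
rewrite andbT; apply/hasPn => x /flattenP[t tss xt]; apply/negP => xs.
have st : s != t by apply: contraNneq sss => ->.
have := dss s t (mem_head _ _); rewrite inE tss orbT => /(_ isT st).
by rewrite disjoint_subset => /subsetP/(_ x); rewrite !inE xs xt => /(_ isT).
Qed.

Lemma mem_bigcup_seq (T : finType) (ss : seq (seq T)) x :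
  (x \in \bigcup_(s <- ss) [set:: s]) = (x \in flatten ss).
Proof.
elim: ss => [|s ss IH]; first by rewrite big_nil inE.
by rewrite big_cons inE IH mem_cat inE.
Qed.

(** * Values of derivation trees *)

(** Terminals go to corollas, which turns [subst] into an instance of [gsubst]; [h] is the identity
    for values and [inr] for new right-hand sides. *)
Definition on_sum (N Sigma : rankedAlphabet) B (h : Sigma -> B) (f : N -> tree B nat)
    (a : N + Sigma) : tree B nat :=
  match a with inl C => f C | inr s => corolla (h s) (rk s) end.

Lemma subst_gsubst (N Sigma : rankedAlphabet) (f : N -> tree Sigma nat)
    (t : tree (N + Sigma) nat) :
  ranked (@sum_rk N Sigma) t -> subst f t = gsubst (on_sum id f) t.
Proof.
elim/tree_nested_ind: t => //= -[C|s] ts IH /andP[/eqP sz /allP rts].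
  by congr graft; apply/funext => j; congr nth; apply/eq_in_map => t tts; apply: IH => //; apply: rts.
rewrite /= in sz; rewrite -[on_sum id f (inr s)]/(corolla s (rk s)) -sz -[size ts](size_map (gsubst (on_sum id f))) inst_corolla.
by congr Node; apply/eq_in_map => t tts; apply: IH => //; apply: rts.
Qed.

Lemma pattern_corolla A (rnk : A -> nat) a : pattern rnk (rnk a) (corolla a (rnk a)).
Proof.
rewrite /pattern /= size_map size_iota eqxx all_map /=.
rewrite -map_comp (_ : flatten _ = iota 0 (rnk a)) ?perm_refl ?andbT; first exact/allP.
by elim: (iota _ _) => //= i s ->.
Qed.

Lemma Forall2_zip (T U : eqType) (R : T -> U -> Prop) s u :
  List.Forall2 R s u -> size s = size u /\ {in zip s u, forall p, R p.1 p.2}.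
Proof.
elim=> //= x y {}s {}u Rxy _ [-> H]; split=> // p.
by rewrite inE => /predU1P[->|/H].
Qed.

Lemma zip_Forall2 (T U : eqType) (R : T -> U -> Prop) s u :
  size s = size u -> {in zip s u, forall p, R p.1 p.2} -> List.Forall2 R s u.
Proof.
elim: s u => [|x s IH] [|y u] //= [sz] H; constructor; first by apply: (H (x, y)); rewrite mem_head.
by apply: IH => // p pl; apply: H; rewrite inE pl orbT.
Qed.

Section GrammarFacts.
Variables (Sigma : rankedAlphabet) (G : mcftg Sigma).
Local Notation N := (nonterm G).

Lemma links_flatten_uniq (r : grule G) : uniq (flatten (links r)).
Proof.
apply: uniq_flatten; first exact: mcftg_links_uniq.
  by move=> B /mcftg_links_big/mcftg_big_uniq.
by move=> B B' Br B'r; apply: mcftg_links_disjoint Br B'r.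
Qed.

Lemma nonterminals_links (r : grule G) :
  perm_eq (nonterminals (rhs r)) (flatten (links r)).
Proof.
apply: uniq_perm; [exact: mcftg_rhs_uniq | exact: links_flatten_uniq |].
move=> C; rewrite -mem_bigcup_seq mcftg_links_cover.
by rewrite inE.
Qed.

Lemma mem_nonterminals (N' : rankedAlphabet) (u : seq (tree (N' + Sigma) nat)) C :
  (C \in nonterminals u) = (inl C \in forest_labels u).
Proof.
by rewrite /nonterminals; elim: (forest_labels u) => //= -[D|s] l IH; rewrite !inE IH.
Qed.

Lemma mem_forest_labels (N' : rankedAlphabet) (u : seq (tree (N' + Sigma) nat)) t a :
  t \in u -> a \in labels t -> a \in forest_labels u.
Proof. by move=> tu ta; apply/flattenP; exists (labels t) => //; apply: map_f. Qed.

Lemma rhs_label_link (r : grule G) t C :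
  t \in rhs r -> inl C \in labels t -> C \in flatten (links r).
Proof.
move=> tr Ct; rewrite -(perm_mem (nonterminals_links r)) mem_nonterminals.
exact: mem_forest_labels Ct.
Qed.

Lemma all2_memr T (U : eqType) (P : T -> U -> bool) s u y :
  all2 P s u -> y \in u -> exists x, P x y.
Proof.
elim: s u => [|x s IH] [|z u] //= /andP[Pxz Psu]; rewrite inE => /predU1P[->|/(IH _ Psu)//].
by exists x.
Qed.

Lemma rhs_ranked (r : grule G) : {in rhs r, forall t, ranked (@sum_rk N Sigma) t}.
Proof. by move=> t /(all2_memr (mcftg_rhs_pattern r))[C /andP[]]. Qed.

Lemma rhs_pattern_gsubst (B : eqType) (rB : B -> nat) (h : Sigma -> B)
    (f : N -> tree B nat) (r : grule G) :
  (forall s, rB (h s) = rk s) ->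
  {in flatten (links r), forall C, pattern rB (rk C) (f C)} ->
  all2 (fun C t => pattern rB (rk C) t) (lhs r) (map (gsubst (on_sum h f)) (rhs r)).
Proof.
move=> hB pf; have pm t : t \in rhs r -> pattern_map (@sum_rk N Sigma) rB (on_sum h f) (labels t).
  move=> tr [C|s] at_ /=; first by apply: pf; apply: rhs_label_link at_.
  by rewrite -hB pattern_corolla.
have := mcftg_rhs_pattern r.
elim: (lhs r) (rhs r) pm => [|C l IH] [|t u] //= pm /andP[/andP[rt pt] lu].
rewrite IH // ?andbT; last by move=> v vu; apply: pm; rewrite inE vu orbT.
have [rgt lt _] := gsubst_pattern rt (pm t (mem_head _ _)).
by rewrite /pattern rgt (perm_trans lt).
Qed.

(** [der_from] recurses through [Forall2], so the induction runs over the tree and each step inverts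
    the derivation. *)
Lemma der_from_nested_ind (P : seq N -> tree (rule_alphabet G) void -> Prop) :
  (forall (r : grule G) ds, size (links r) = size ds ->
     {in zip (links r) ds, forall p, der_from p.1 p.2 /\ P p.1 p.2} ->
     P (lhs r) (Node (r : rule_alphabet G) ds)) ->
  forall A d, der_from A d -> P A d.
Proof.
move=> PN A d; elim/tree_nested_ind: d A => [[]|r ds IH] A H.
inversion H as [r' ds' H' EA [Er Eds]]; subst; clear H.
have [sz H] := Forall2_zip H'; apply: PN => // p pz; split; first exact: H.
apply: IH (H p pz); have <- : unzip2 (zip (links r) ds) = ds by rewrite unzip2_zip // sz.
exact: (map_f snd pz).
Qed.

Lemma der_from_node (r : rule_alphabet G) ds :
  size (links r) = size ds -> {in zip (links r) ds, forall p, der_from p.1 p.2} ->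
  der_from (lhs r) (Node r ds).
Proof.
by move=> sz H; constructor; apply: zip_Forall2.
Qed.

Lemma der_ranked A (d : tree (rule_alphabet G) void) :
  der_from A d -> ranked (@rk (rule_alphabet G)) d.
Proof.
move: A d; apply: der_from_nested_ind => r ds sz H /=; rewrite sz eqxx /=.
elim: (links r) ds sz H => [|B l IH] [|d ds] //= [sz] H.
rewrite IH // ?andbT; last by move=> p pl; apply: H; rewrite inE pl orbT.
by have [] := H (B, d) (mem_head _ _).
Qed.

Lemma val_node (r : grule G) ds :
  size (links r) = size ds ->
  {in zip (links r) ds, forall p, size p.1 = size (Defs.val p.2)} ->
  exists2 f : N -> tree Sigma nat,
    Defs.val (Node (r : rule_alphabet G) ds) = map (gsubst (on_sum id f)) (rhs r) &
    {in zip (links r) ds, forall p, map f p.1 = Defs.val p.2}.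
Proof.
move=> sz szp; exists (fun C => nth (Leaf 0) (flatten (map (@Defs.val Sigma G) ds))
                           (index C (flatten (links r)))).
  by apply/eq_in_map => t /rhs_ranked; apply: subst_gsubst.
have E1 : links r = map fst (zip (links r) ds) by rewrite -/unzip1 unzip1_zip // sz.
have E2 : map (@Defs.val Sigma G) ds = map (fun p => Defs.val p.2) (zip (links r) ds).
  have u2 : unzip2 (zip (links r) ds) = ds by rewrite unzip2_zip // sz.
  by rewrite -[in LHS]u2 -map_comp.
have := @map_index_flatten _ _ _ (Leaf 0) (zip (links r) ds) fst (fun p => Defs.val p.2).
by rewrite -E1 -E2; apply=> //; apply: links_flatten_uniq.
Qed.

Lemma all2_size T U (P : T -> U -> bool) s u : all2 P s u -> size s = size u.
Proof. by elim: s u => [|x s IH] [|y u] //= /andP[_ /IH ->]. Qed.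

Lemma zip_links_mem (r : grule G) (U : eqType) (ds : seq U) C :
  size (links r) = size ds -> C \in flatten (links r) ->
  exists2 p, p \in zip (links r) ds & C \in p.1.
Proof.
move=> sz /flattenP[B Br CB]; have lt : index B (links r) < size (links r) by rewrite index_mem.
case: ds sz => [|d0 ds] sz; first by rewrite sz in lt.
exists (nth (B, d0) (zip (links r) (d0 :: ds)) (index B (links r))).
  by apply: mem_nth; rewrite size_zip -sz minnn.
by rewrite nth_zip //= nth_index.
Qed.

Lemma val_patterns A (d : tree (rule_alphabet G) void) :
  der_from A d -> all2 (fun C t => pattern (@rk Sigma) (rk C) t) A (Defs.val d).
Proof.
move: A d; apply: der_from_nested_ind => r ds sz H.
have [|f -> fE] := val_node sz; first by move=> p /H[_ /all2_size].
apply: rhs_pattern_gsubst => // C /(zip_links_mem sz)[p pz Cp].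
have [_] := H p pz; rewrite -(fE p pz) all2_mapr => /allP; exact.
Qed.

End GrammarFacts.

(** * The footed grammar *)

Section Construction.
Variables (Sigma : rankedAlphabet) (G : mcftg Sigma) (hwidth : 1 <= width G).
Local Notation N := (nonterm G).
Local Notation mr := (maxrank Sigma).

Definition bound := mr * (2 * width G - 1).

(** A ground pattern is one piece, although the formula for zero variables leaves no room for it;
    the assumption on the width enters here. *)
Lemma bound_gt0 : 0 < bound.
Proof. by rewrite muln_gt0 (mcftg_maxrank G); lia. Qed.

Definition skeleton_ok (C : N) (s : tree unit nat) : bool :=
  [&& perm_eq (leaves s) (iota 0 (rk C)), all (fun m => m <= mr) (arities s)
    & size (arities s) <= bound].

Definition index_seq : seq (seq N * seq (tree unit nat)) :=
  [seq p <- [seq (A, ss) | A <- big G,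
       ss <- seqs_upto (small_trees mr (width G) bound) (multiplicity G)]
   | all2 skeleton_ok p.1 p.2].

Lemma rk_le_width (C : N) : rk C <= width G.
Proof. exact: (@leq_bigmax _ (fun C : N => rk C)). Qed.

Lemma size_le_multiplicity A : A \in big G -> size A <= multiplicity G.
Proof. by move=> AG; rewrite /multiplicity; apply: leq_bigmax_seq. Qed.

Lemma mem_index_seq A ss :
  (A, ss) \in index_seq = (A \in big G) && all2 skeleton_ok A ss.
Proof.
rewrite mem_filter /= andbC; apply/andP/andP => -[].
  by case/allpairsP => -[A' ss'] [/= AG _ [-> _]] ->.
move=> AG ok; split=> //; apply/allpairsP; exists (A, ss); split=> //=.
apply: mem_seqs_upto; first by rewrite -(all2_size ok) size_le_multiplicity.
move=> s /(all2_memr ok)[C /and3P[lf ar sz]]; apply: mem_small_trees => // j jl.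
by apply: leq_trans (leaf_lt_rank lf jl) (rk_le_width C).
Qed.

Lemma start_index_subproof : ([:: start G], [:: Node tt [::]]) \in index_seq.
Proof.
rewrite mem_index_seq mcftg_start_big /= andbT /skeleton_ok mcftg_start_rk /=.
by rewrite bound_gt0.
Qed.

Definition index_type : finType := seq_sub index_seq.
Local Notation I := index_type.

(* The index of the start symbol is present even if [L(G)] is empty. *)
Definition start_index : I := SeqSub start_index_subproof.
Definition nt (i : I) : seq N := (ssval i).1.
Definition skel (i : I) : seq (tree unit nat) := (ssval i).2.
Definition rank_list (i : I) : seq nat := forest_arities (skel i).
Definition npieces (i : I) : nat := size (rank_list i).
Definition max_pieces : nat := multiplicity G * bound.

(* Numbers beyond [npieces i] give junk nonterminals, which occur in no big
   nonterminal. *)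
Definition piece_nt : rankedAlphabet :=
  @RankedAlphabet (I * 'I_max_pieces.+1)%type (fun C => nth 0 (rank_list C.1) C.2).

Definition block (i : I) : seq piece_nt :=
  [seq (i, inord j) : piece_nt | j <- iota 0 (npieces i)].

Lemma nt_big i : nt i \in big G.
Proof. by case: i => -[A ss] p; have := p; rewrite {1} mem_index_seq => /andP[]. Qed.

Lemma skel_ok i : all2 skeleton_ok (nt i) (skel i).
Proof. by case: i => -[A ss] p; have := p; rewrite {1} mem_index_seq => /andP[]. Qed.

Lemma index_inj i j : nt i = nt j -> skel i = skel j -> i = j.
Proof.
case: i j => [[A ss] p] [[A' ss'] p']; rewrite /nt /skel /= => E E'.
by apply: val_inj; rewrite /= E E'.
Qed.

Lemma npieces_le i : npieces i <= size (nt i) * bound.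
Proof.
rewrite /npieces /rank_list /forest_arities.
elim: (nt i) (skel i) (skel_ok i) => [|C A IH] [|s ss] //= /andP[/and3P[_ _ sz] /IH].
by rewrite size_cat mulSn => H; apply: leq_add.
Qed.

Lemma npieces_max i : npieces i <= max_pieces.
Proof.
apply: leq_trans (npieces_le i) _.
by rewrite /max_pieces leq_mul2r (size_le_multiplicity (nt_big i)) orbT.
Qed.

Lemma size_block i : size (block i) = npieces i.
Proof. by rewrite size_map size_iota. Qed.

Lemma block_uniq i : uniq (block i).
Proof.
rewrite map_inj_in_uniq ?iota_uniq // => j k; rewrite !mem_iota /= => lj lk [].
move/(congr1 val); rewrite /= !inordK //; have := npieces_max i; lia.
Qed.

Lemma rk_block i : map (@rk piece_nt) (block i) = rank_list i.
Proof.
rewrite -map_comp; apply: (@eq_from_nth _ 0); rewrite size_map size_iota // => j lj.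
rewrite (nth_map 0) ?size_iota // nth_iota //= inordK //; have := npieces_max i; lia.
Qed.

Lemma mem_block i (C : piece_nt) : C \in block i -> C.1 = i.
Proof. by case/mapP => j _ ->. Qed.

(** This closes the construction: placeholders obey the same bound on ranks as terminals, so cutting
    a right-hand side that contains them yields an admissible skeleton again. Junk nonterminals get
    rank 0. *)
Lemma rk_piece_nt (C : piece_nt) : rk C <= mr.
Proof.
case: C => i j /=; have [lt|le] := ltnP j (npieces i); last by rewrite nth_default.
suff /allP : all (fun m => m <= mr) (rank_list i) by apply; apply: mem_nth.
rewrite /rank_list /forest_arities all_flatten all_map.
apply/allP => s /(all2_memr (skel_ok i))[C /and3P[]] //.
Qed.

Definition named (i : I) : seq (tree piece_nt nat) :=
  fills ((start_index, ord0) : piece_nt) (block i) (skel i).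

Lemma flatten_nodes_size A X (ts : seq (tree A X)) :
  size (flatten (map (@nodes A X) ts)) = size (forest_arities ts).
Proof. by rewrite /forest_arities; elim: ts => //= t ts IH; rewrite !size_cat IH size_map. Qed.

(** [block i] has one name for each node of [skel i], so the default label in [named] never
    appears. *)
Lemma named_spec i :
  flatten (map (@labels _ _) (named i)) = block i /\ map (@shape _ _) (named i) = skel i.
Proof.
apply: fills_spec; first by case.
by rewrite size_block flatten_nodes_size.
Qed.

Lemma named_pattern i :
  all2 (fun C t => pattern (@rk piece_nt) (rk C) t) (nt i) (named i).
Proof.
have [El Es] := named_spec i.
have rn : all (ranked (@rk piece_nt)) (named i).
  apply: forest_ranked_arities; rewrite El rk_block /rank_list -Es /forest_arities.
  by rewrite -map_comp; congr flatten; apply/eq_map => t /=; rewrite arities_lmap.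
have := skel_ok i; rewrite -Es.
elim: (nt i) (named i) rn => [|C A IH] [|t ts] //= /andP[rt rts] /andP[/and3P[lf _ _] H].
by rewrite IH // andbT /pattern rt -(leaves_lmap (fun _ => tt)).
Qed.

Lemma size_nt_named i : size (nt i) = size (named i).
Proof. exact: all2_size (named_pattern i). Qed.

(** The same lookup as in [forest_subst], so that [map_index_flatten] serves both. *)
Definition link_named (r : grule G) (js : seq I) (C : N) : tree piece_nt nat :=
  nth (Leaf 0) (flatten (map named js)) (index C (flatten (links r))).

Definition link_tree (r : grule G) (js : seq I) (C : N) : tree (piece_nt + Sigma) nat :=
  lmap inl (link_named r js C).

Definition new_forest (r : grule G) (js : seq I) : seq (tree (piece_nt + Sigma) nat) :=
  map (gsubst (on_sum inr (link_tree r js))) (rhs r).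

Definition aligned (r : grule G) (js : seq I) := map nt js = links r.

Lemma map_link_named r js : aligned r js ->
  {in js, forall i, map (link_named r js) (nt i) = named i}.
Proof.
move=> al; rewrite /link_named -al; apply: map_index_flatten.
  by rewrite al links_flatten_uniq.
by move=> i _; apply: size_nt_named.
Qed.

Lemma aligned_mem r js C : aligned r js -> C \in flatten (links r) ->
  exists2 i, i \in js & C \in nt i.
Proof. by move=> <- /flattenP[_ /mapP[i ijs ->] Ci]; exists i. Qed.

Lemma link_named_pattern r js : aligned r js ->
  {in flatten (links r), forall C, pattern (@rk piece_nt) (rk C) (link_named r js C)}.
Proof.
move=> al C /(aligned_mem al)[i ijs Ci].
by have := named_pattern i; rewrite -(map_link_named al ijs) all2_mapr => /allP; apply.
Qed.

Lemma ranked_lmap A B X (f : A -> B) (rA : A -> nat) (rB : B -> nat) (t : tree A X) :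
  (forall a, rB (f a) = rA a) -> ranked rA t -> ranked rB (lmap f t).
Proof.
move=> E; elim/tree_nested_ind: t => //= a ts IH /andP[sz /allP rts].
by rewrite size_map E sz /= all_map; apply/allP => t tts /=; apply: IH => //; apply: rts.
Qed.

Lemma link_tree_pattern r js : aligned r js ->
  {in flatten (links r), forall C,
     pattern (@sum_rk piece_nt Sigma) (rk C) (link_tree r js C)}.
Proof.
move=> al C /(link_named_pattern al)/andP[rn pn]; rewrite /pattern leaves_lmap pn andbT.
exact: ranked_lmap rn.
Qed.

Lemma new_forest_pattern r js : aligned r js ->
  all2 (fun C t => pattern (@sum_rk piece_nt Sigma) (rk C) t) (lhs r) (new_forest r js).
Proof. by move=> al; apply: rhs_pattern_gsubst => //; apply: link_tree_pattern. Qed.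

(** Applied to two alphabets: the terminals alone for actual values, and terminals with placeholders
    for new right-hand sides. *)
Lemma skeleton_okP (A : eqType) (rnk : A -> nat) (C : N) t : (forall a, rnk a <= mr) ->
  pattern rnk (rk C) t -> skeleton_ok C (shape (dec t)).
Proof.
move=> rle /andP[rt lt]; rewrite /skeleton_ok leaves_lmap leaves_dec lt /=.
have ar : all (fun m => m <= mr) (arities t).
  by rewrite (arities_ranked rt) all_map; apply/allP => a _ /=.
rewrite arities_lmap dec_arities //= /arities size_map.
have [g|ng] := boolP (ground t); first by rewrite size_dec_ground ?bound_gt0.
have := size_dec (mcftg_maxrank G) ar ng; rewrite (perm_size lt) size_iota.
have := rk_le_width C; rewrite /bound; nia.
Qed.

Lemma skeletons_ok (A : eqType) (rnk : A -> nat) (Cs : seq N) w : (forall a, rnk a <= mr) ->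
  all2 (fun C t => pattern rnk (rk C) t) Cs w -> all2 skeleton_ok Cs (skeletons w).
Proof.
move=> rle; elim: Cs w => [|C Cs IH] [|t w] //= /andP[/(skeleton_okP rle) -> /IH].
exact.
Qed.

Lemma sum_rk_le (a : piece_nt + Sigma) : sum_rk a <= mr.
Proof. by case: a => [C|s] /=; [apply: rk_piece_nt | apply: (@leq_bigmax _ (fun s : Sigma => rk s))]. Qed.

(** The skeletons of the left-hand side are not guessed but computed from those of the links. The
    default is taken only for sequences that do not match the links. *)
Definition new_index (r : grule G) (js : seq I) : I :=
  insubd start_index (lhs r, skeletons (new_forest r js)).

Lemma new_indexE r js : aligned r js ->
  nt (new_index r js) = lhs r /\ skel (new_index r js) = skeletons (new_forest r js).
Proof.
move=> al; rewrite /nt /skel /new_index -[ssval _]/(val _) val_insubd mem_index_seq mcftg_lhs_big.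
by rewrite (skeletons_ok sum_rk_le (new_forest_pattern al)).
Qed.

(** * Soundness of the cut *)

Definition interprets (g : piece_nt -> tree Sigma nat) (i : I) (w : seq (tree Sigma nat)) :=
  [/\ all2 (fun C t => pattern (@rk Sigma) (rk C) t) (nt i) w, skeletons w = skel i
    & map g (block i) = pieces w].

(** The name in position [j] is sent to the piece in position [j]; the number of children of that
    piece in the decomposition is the rank of the name. *)
Lemma interprets_foot g i w : interprets g i w ->
  {in block i, forall C, foot (@rk Sigma) (rk C) (g C)}.
Proof.
move=> [pw sw gw] C Ci.
have E : [seq (g C, rk C) | C <- block i] = flatten (map (fun t => nodes (dec t)) w).
  rewrite -zip_pieces sw -gw -/(rank_list i) -rk_block.
  by elim: (block i) => //= D l ->.
have := map_f (fun C => (g C, rk C)) Ci; rewrite E => /flattenP[_ /mapP[t tw ->]].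
have [D /andP[rt _]] := all2_memr pw tw.
exact: (dec_foot rt).
Qed.

Lemma map_gsubst_named g i w : interprets g i w -> map (gsubst g) (named i) = w.
Proof.
move=> [_ sw gw]; have -> : map (gsubst g) (named i) = map (gsubst id) (map (lmap g) (named i)).
  by rewrite -map_comp; apply/eq_map => t /=; rewrite gsubst_lmap.
rewrite /named map_lmap_fills gw -sw.
have := fills_labels (g (start_index, ord0)) (fun _ => tt) (map (@dec Sigma) w).
rewrite -!map_comp => ->.
by rewrite -[RHS]map_id -map_comp; apply/eq_map => t /=; apply: gsubst_id_dec.
Qed.

Lemma gsubst_link g (f : N -> tree Sigma nat) r js : aligned r js ->
  {in js, forall i, interprets g i (map f (nt i))} ->
  {in flatten (links r), forall C, gsubst (on_sum id g) (link_tree r js C) = f C}.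
Proof.
move=> al H C /(aligned_mem al)[i ijs Ci]; rewrite /link_tree gsubst_lmap.
have := map_gsubst_named (H i ijs); rewrite -(map_link_named al ijs) -map_comp.
by move/eq_in_map => /(_ C Ci) /= <-.
Qed.

Lemma mem_labels_link_tree r js C D : aligned r js -> C \in flatten (links r) ->
  D \in labels (link_tree r js C) -> exists2 i, i \in js & D \in map inl (block i).
Proof.
move=> al /(aligned_mem al)[i ijs Ci]; rewrite labels_lmap => /mapP[E Et ->].
exists i => //; apply: map_f; have [<- _] := named_spec i.
apply/flattenP; exists (labels (link_named r js C)) => //; apply: map_f.
by rewrite -(map_link_named al ijs); apply: map_f.
Qed.

(** The core of soundness: cutting the value equals cutting the new forest and then inserting the
    pieces. [dec_gsubst] applies because names stand for footed patterns and terminals for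
    corollas. *)
Lemma dec_new_forest g (f : N -> tree Sigma nat) r js : aligned r js ->
  {in js, forall i, interprets g i (map f (nt i))} ->
  map (@dec Sigma) (map (gsubst (on_sum id f)) (rhs r)) =
  map (lmap (gsubst (on_sum id g))) (map (@dec (piece_nt + Sigma)%type) (new_forest r js)).
Proof.
move=> al H; rewrite -!map_comp; apply/eq_in_map => t tr /=.
have rt := rhs_ranked tr.
have pl : pattern_map (@sum_rk N Sigma) (@sum_rk piece_nt Sigma)
    (on_sum inr (link_tree r js)) (labels t).
  move=> [C|s] at_ /=; last exact: pattern_corolla.
  by apply: link_tree_pattern => //; apply: rhs_label_link at_.
have fg a D : a \in labels t -> D \in labels (on_sum inr (link_tree r js) a) ->
    foot (@rk Sigma) (sum_rk D) (on_sum id g D).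
  case: a => [C|s] at_ /=.
    case/(mem_labels_link_tree al (rhs_label_link tr at_)) => i ijs /mapP[E Ei ->] /=.
    exact: (interprets_foot (H i ijs)).
  rewrite inE => /predU1P[->|]; first exact: Foot_here.
  by rewrite -map_comp => /flattenP[_ /mapP[? _ ->]].
have [rg _ lg] := gsubst_pattern rt pl.
rewrite -(dec_gsubst (rB := @rk Sigma) rg); last first.
  move=> D; rewrite (perm_mem lg) => /flattenP[_ /mapP[a at_ ->]]; exact: fg.
(* Below the decomposition, inserting named skeletons and then pieces amounts to inserting the
   values given by [f]. *)
congr dec; rewrite (gsubst_gsubst (rB := @sum_rk piece_nt Sigma)); last first.
  move=> a at_; have /andP[ra _] := pl a at_; split=> // D Da.
  by rewrite (foot_leaves (fg a D at_ Da)).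
apply: eq_in_gsubst => -[C|s] at_ /=; last by rewrite -map_comp inst_Leafs.
by rewrite (gsubst_link al H) //; apply: rhs_label_link at_.
Qed.

Lemma skeletons_new_forest g (f : N -> tree Sigma nat) r js : aligned r js ->
  {in js, forall i, interprets g i (map f (nt i))} ->
  skeletons (map (gsubst (on_sum id f)) (rhs r)) = skeletons (new_forest r js).
Proof.
move=> al H; rewrite /skeletons (map_comp (@shape _ _) (@dec Sigma)) (dec_new_forest al H).
by rewrite -!map_comp; apply/eq_map => t /=; rewrite shape_lmap.
Qed.

Lemma new_forest_ranked r js : aligned r js ->
  {in new_forest r js, forall t, ranked (@sum_rk piece_nt Sigma) t}.
Proof. by move=> al t /(all2_memr (new_forest_pattern al))[C /andP[]]. Qed.

Lemma pieces_new_forest g (f : N -> tree Sigma nat) r js : aligned r js ->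
  {in js, forall i, interprets g i (map f (nt i))} ->
  pieces (map (gsubst (on_sum id f)) (rhs r)) = map (subst g) (pieces (new_forest r js)).
Proof.
move=> al H; rewrite /pieces (map_comp (@labels _ _) (@dec Sigma)) (dec_new_forest al H).
rewrite map_flatten -!map_comp; congr flatten; apply/eq_in_map => t tn /=.
rewrite labels_lmap; apply/eq_in_map => p pt; apply/esym/subst_gsubst.
exact: (allP (dec_ranked (new_forest_ranked al (map_f _ tn))) p pt).
Qed.

(** * Symbols of the new right-hand sides *)

Lemma labels_pieces (A : eqType) (w : seq (tree A nat)) :
  perm_eq (flatten (map (@labels A nat) (pieces w))) (flatten (map (@labels A nat) w)).
Proof.
rewrite /pieces; elim: w => //= t w IH; rewrite map_cat flatten_cat.
by apply: perm_cat => //; apply: labels_dec.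
Qed.

Lemma forest_labels_new r js : aligned r js ->
  perm_eq (forest_labels (pieces (new_forest r js)))
    (flatten (map (fun a => labels (on_sum inr (link_tree r js) a)) (forest_labels (rhs r)))).
Proof.
move=> al; rewrite (perm_trans (labels_pieces _)) // /new_forest /forest_labels.
have H t : t \in rhs r -> perm_eq (labels (gsubst (on_sum inr (link_tree r js)) t))
    (flatten (map (fun a => labels (on_sum inr (link_tree r js) a)) (labels t))).
  move=> tr; have [|//] := gsubst_pattern (rB := @sum_rk piece_nt Sigma) (rhs_ranked tr)
     (f := on_sum inr (link_tree r js)).
  move=> [C|s] at_ /=; last exact: pattern_corolla.
  by apply: link_tree_pattern => //; apply: rhs_label_link at_.
elim: (rhs r) H => //= t u IH H; rewrite map_cat flatten_cat.
apply: perm_cat; first by apply: H; rewrite mem_head.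
by apply: IH => v vu; apply: H; rewrite inE vu orbT.
Qed.

(** Cutting neither loses nor duplicates a symbol, and each nonterminal of the old right-hand side
    brings the names of its skeleton once. This yields the link conditions of the new grammar. *)
Lemma nonterminals_new r js : aligned r js ->
  perm_eq (nonterminals (pieces (new_forest r js))) (flatten (map block js)).
Proof.
move=> al; rewrite /nonterminals.
rewrite (perm_trans (perm_pmap _ (forest_labels_new al))) //.
set toN := (X in pmap X _).
have -> : pmap toN (flatten (map (fun a => labels (on_sum inr (link_tree r js) a))
      (forest_labels (rhs r)))) =
    flatten (map (fun C => labels (link_named r js C)) (nonterminals (rhs r))).
  rewrite /nonterminals; elim: (forest_labels (rhs r)) => //= -[C|s] l IH /=.
    by rewrite pmap_cat IH labels_lmap; congr cat; elim: (labels _) => //= D m ->.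
  by rewrite pmap_cat IH -map_comp; elim: (iota _ _) => //= ? ? ->.
rewrite (perm_trans (perm_flatten (perm_map _ (nonterminals_links r)))) //.
have -> : map (fun C => labels (link_named r js C)) (flatten (links r)) =
    flatten (map (fun i => map (@labels _ _) (named i)) js).
  rewrite -al map_flatten -!map_comp; congr flatten; apply/eq_in_map => i ijs /=.
  by rewrite -(map_link_named al ijs) -map_comp.
have -> : flatten (flatten (map (fun i => map (@labels _ _) (named i)) js)) =
    flatten (map block js).
  elim: js {al} => //= i js IH; rewrite flatten_cat IH.
  by have [-> _] := named_spec i.
by [].
Qed.

Lemma terminals_new r js s : aligned r js ->
  inr s \in forest_labels (rhs r) -> inr s \in forest_labels (pieces (new_forest r js)).
Proof.
move=> al sr; rewrite (perm_mem (forest_labels_new al)); apply/flattenP.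
by exists (labels (on_sum inr (link_tree r js) (inr s))); [apply: map_f | rewrite inE eqxx].
Qed.

Lemma In_mem (T : eqType) (x : T) s : List.In x s <-> x \in s.
Proof.
elim: s => //= y s IH; rewrite inE; split.
  by case=> [->|/IH ->]; rewrite ?eqxx ?orbT.
by case/predU1P => [->|/IH]; [left | right].
Qed.

Lemma foot_footed A (rnk : A -> nat) m p : foot rnk m p -> footed_pattern rnk m p.
Proof.
have [->|m0] := posnP m; first by left.
move=> fp; right; split=> //; elim: fp m0 => {m p} // [a|a m ts1 t ts2 _ _ _ IH] m0.
  by exists a; split=> //; left.
have [b [rb /In_mem bt]] := IH m0; exists b; split=> //; apply/In_mem.
rewrite inE; apply/orP; right; apply/flattenP; exists (subtrees t) => //.
by apply: map_f; rewrite mem_cat mem_head orbT.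
Qed.

Lemma zip_foot (A : eqType) (rA : A -> nat) (w : seq (tree A nat)) (Cs : seq piece_nt) :
  all (ranked rA) w -> map (@rk piece_nt) Cs = forest_arities (skeletons w) ->
  size Cs = size (pieces w) /\
  {in zip Cs (pieces w), forall x, ranked rA x.2 /\ foot rA (rk x.1) x.2}.
Proof.
move=> /allP rw E; have sz : size Cs = size (pieces w).
  by rewrite size_pieces -E size_map.
split=> // x xz.
have : (x.2, rk x.1) \in flatten (map (fun t => nodes (dec t)) w).
  rewrite -zip_pieces -E; move: xz; elim: (Cs) (pieces w) => [|C l IH] [|p ps] //=.
  by rewrite !inE => /predU1P[->|/IH ->]; rewrite ?eqxx ?orbT.
case/flattenP => _ /mapP[t tw ->] xt; split; last exact: (dec_foot (rw t tw) xt).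
apply: (allP (dec_ranked (rw t tw))); rewrite -unzip1_nodes.
exact: (map_f fst xt).
Qed.

(** * Rules of the new grammar and their representatives *)

Definition live (i : I) : bool := 0 < npieces i.

Lemma blockP i : (block i != [::]) = live i.
Proof. by rewrite -size_eq0 size_block -lt0n. Qed.

Lemma eq_set_seq (T : finType) (s s' : seq T) : [set:: s] = [set:: s'] -> s =i s'.
Proof. by move=> /setP E x; have := E x; rewrite !inE. Qed.

(** Every name carries its index, so a nonempty block determines it. Dead blocks are all empty and
    determine nothing. *)
Lemma block_inj i j : live i -> [set:: block i] = [set:: block j] -> i = j.
Proof.
move=> li /eq_set_seq E; have : 0 < size (block i) by rewrite size_block.
case Ei : (block i) => [//|C l] _.
have Ci : C \in block i by rewrite Ei; apply: mem_head.
by rewrite -(mem_block Ci); apply: mem_block; rewrite -E.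
Qed.

Definition new_big : seq (seq piece_nt) := [seq block i | i <- enum I & live i].

Lemma mem_new_big A : reflect (exists2 i, live i & A = block i) (A \in new_big).
Proof.
apply: (iffP mapP) => [[i]|[i li ->]]; last first.
  by exists i => //; rewrite mem_filter li; apply: mem_enum.
by rewrite mem_filter => /andP[li _] ->; exists i.
Qed.

(** A classical truth value; it secures a derivation tree of [G] for each link that the backward
    transducer has to restore. *)
Definition realized (i : I) : bool :=
  `[< exists2 d, der_from (nt i) d & skeletons (Defs.val d) = skel i >].

Definition max_links : nat := \max_(r : grule G) size (links r).

Definition prerule : finType := (grule G * {bseq max_links of I})%type.

Implicit Type p : prerule.

Definition pre_index p : I := new_index p.1 p.2.
Definition pre_lhs p : seq piece_nt := block (pre_index p).
Definition pre_rhs p : seq (tree (piece_nt + Sigma) nat) := pieces (new_forest p.1 p.2).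
Definition pre_links p : seq (seq piece_nt) := [seq block i | i <- p.2 & live i].

Definition valid p : bool :=
  [&& map nt p.2 == links p.1, all realized p.2 & live (pre_index p)].

(* Different rules of [G] can yield the same rule of [G'], whose rules must be
   pairwise distinct; one representative is kept. *)
Definition same_rule p q : bool :=
  [&& pre_lhs p == pre_lhs q, pre_rhs p == pre_rhs q & perm_eq (pre_links p) (pre_links q)].

Definition rep p : prerule := odflt p [pick q | valid q && same_rule q p].

(** [pick] gives equal results on predicates that agree pointwise, and those of [p] and [rep p]
    agree because [same_rule] is an equivalence. As a valid [p] is itself a candidate, the default
    is not reached. *)
Lemma repP p : valid p -> [/\ valid (rep p), same_rule (rep p) p & rep (rep p) == rep p].
Proof.
move=> vp; have same_refl q : same_rule q q by rewrite /same_rule !eqxx perm_refl.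
have H q : valid q -> valid (rep q) && same_rule (rep q) q.
  by move=> vq; rewrite /rep; case: pickP => [//|/(_ q)]; rewrite vq same_refl.
have /andP[vr sr] := H p vp; split=> //.
have pickE : (fun q => valid q && same_rule q (rep p)) =1 (fun q => valid q && same_rule q p).
  move=> q; case: (valid q) => //=; move: sr => /and3P[/eqP E1 /eqP E2 /permPr E3].
  by rewrite /same_rule E1 E2 E3.
have Ep : [pick q | valid q && same_rule q p] = Some (rep p).
  by rewrite /rep; case: pickP => // /(_ p); rewrite vp same_refl.
by rewrite {1}/rep (eq_pick pickE) Ep.
Qed.

Lemma valid_aligned p : valid p -> aligned p.1 p.2.
Proof. by case/and3P => /eqP. Qed.

Lemma valid_uniq p : valid p -> uniq p.2.
Proof.
by move=> /valid_aligned al; apply: (@map_uniq _ _ nt); rewrite al mcftg_links_uniq.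
Qed.

Lemma mem_pre_links p B : reflect (exists2 i, (i \in p.2) && live i & B = block i) (B \in pre_links p).
Proof.
apply: (iffP mapP) => -[i]; first by rewrite mem_filter andbC; exists i.
by rewrite andbC => H ->; exists i; rewrite ?mem_filter.
Qed.

Lemma pre_links_uniq p : valid p -> uniq (pre_links p).
Proof.
move=> vp; rewrite map_inj_in_uniq ?filter_uniq ?valid_uniq // => i j.
by rewrite mem_filter => /andP[li _] _ E; apply: block_inj => //; rewrite E.
Qed.

Lemma flatten_pre_links p : flatten (pre_links p) = flatten (map block p.2).
Proof.
rewrite /pre_links; elim: (p.2 : seq I) => //= i l <-.
by have := blockP i; case: (live i) => //= /negbFE/eqP ->.
Qed.

Lemma pre_nonterminals p : valid p ->
  perm_eq (nonterminals (pre_rhs p)) (flatten (pre_links p)).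
Proof. by move=> /valid_aligned al; rewrite flatten_pre_links nonterminals_new. Qed.

Lemma flatten_blocks_uniq (js : seq I) : uniq js -> uniq (flatten (map block js)).
Proof.
elim: js => //= i js IH /andP[ijs ujs]; rewrite cat_uniq block_uniq IH // andbT.
apply/hasPn => C /flattenP[_ /mapP[j jjs ->] Cj]; apply: contra ijs => Ci.
by rewrite -(mem_block Ci) (mem_block Cj).
Qed.

Lemma pre_rhs_uniq p : valid p -> uniq (nonterminals (pre_rhs p)).
Proof.
move=> vp; rewrite (perm_uniq (pre_nonterminals vp)) flatten_pre_links.
by rewrite flatten_blocks_uniq // valid_uniq.
Qed.

Lemma pre_rhs_zip p : valid p ->
  size (pre_lhs p) = size (pre_rhs p) /\
  {in zip (pre_lhs p) (pre_rhs p), forall x,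
     ranked (@sum_rk piece_nt Sigma) x.2 /\ foot (@sum_rk piece_nt Sigma) (rk x.1) x.2}.
Proof.
move=> /valid_aligned al; apply: zip_foot; first exact/allP/new_forest_ranked.
by rewrite rk_block /rank_list; have [_ ->] := new_indexE al.
Qed.

Lemma pre_rhs_pattern p : valid p ->
  all2 (fun C t => pattern (@sum_rk piece_nt Sigma) (rk C) t) (pre_lhs p) (pre_rhs p).
Proof.
move=> /pre_rhs_zip[sz H]; rewrite all2E sz eqxx; apply/allP => x /H[rx fx] /=.
by rewrite /pattern rx (foot_leaves fx); apply: perm_refl.
Qed.

Lemma start_notin_links p : valid p -> start_index \notin p.2.
Proof.
move=> /valid_aligned al; apply/negP => sp.
have : start G \in nonterminals (rhs p.1).
  rewrite (perm_mem (nonterminals_links _)) -al; apply/flattenP.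
  by exists (nt start_index); [apply: map_f | rewrite inE].
by rewrite (negbTE (mcftg_start_sep p.1)).
Qed.

(** * The grammar conditions *)

Definition new_start : piece_nt := (start_index, inord 0).

Definition new_rule : finType := {p : prerule | valid p && (rep p == p)}.

Implicit Type r : new_rule.

Lemma new_rule_valid r : valid (sval r).
Proof. by case: r => p /= /andP[]. Qed.

Lemma new_big_nonempty A : A \in new_big -> A != [::].
Proof. by case/mem_new_big => i li ->; rewrite blockP. Qed.

Lemma new_big_uniq A : A \in new_big -> uniq A.
Proof. by case/mem_new_big => i _ ->; apply: block_uniq. Qed.

Lemma new_big_occ A A' : A \in new_big -> A' \in new_big -> [set:: A] = [set:: A'] -> A = A'.
Proof. by case/mem_new_big => i li -> /mem_new_big[j _ ->] /(block_inj li) ->. Qed.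

Lemma new_start_big : [:: new_start] \in new_big.
Proof. by apply/mem_new_big; exists start_index. Qed.

Lemma new_start_rk : rk new_start = 0.
Proof. by rewrite /= inordK. Qed.

(** Equal data means the same class, hence the same representative. Links agree as sets, which for
    repetition-free sequences gives the permutation that [same_rule] compares. *)
Lemma new_rule_inj r r' : pre_lhs (sval r) = pre_lhs (sval r') ->
  pre_rhs (sval r) = pre_rhs (sval r') ->
  pre_links (sval r) =i pre_links (sval r') -> r = r'.
Proof.
case: r r' => [p pP] [q qP] /= El Er Ek; apply: val_inj => /=.
move: pP qP => /andP[vp /eqP <-] /andP[vq /eqP <-].
have /permPr Ep : perm_eq (pre_links p) (pre_links q) by apply: uniq_perm; rewrite ?pre_links_uniq.
have E : (fun x => valid x && same_rule x p) =1 (fun x => valid x && same_rule x q).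
  by move=> x; rewrite /same_rule El Er Ep.
rewrite /rep (eq_pick E); case: pickP => // /(_ q).
by rewrite vq /same_rule !eqxx perm_refl.
Qed.

Lemma new_lhs_big r : pre_lhs (sval r) \in new_big.
Proof.
by apply/mem_new_big; exists (pre_index (sval r)) => //; case/and3P: (new_rule_valid r).
Qed.

Lemma new_links_big r : {subset pre_links (sval r) <= new_big}.
Proof. by move=> B /mem_pre_links[i /andP[_ li] ->]; apply/mem_new_big; exists i. Qed.

Lemma new_links_disjoint r B B' : B \in pre_links (sval r) -> B' \in pre_links (sval r) ->
  B != B' -> [disjoint [set:: B] & [set:: B']].
Proof.
move=> /mem_pre_links[i _ ->] /mem_pre_links[j _ ->] ij.
rewrite disjoint_subset; apply/subsetP => C; rewrite !inE => Ci; apply: contra ij => Cj.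
by rewrite -(mem_block Ci) (mem_block Cj).
Qed.

Lemma new_links_cover r :
  \bigcup_(B <- pre_links (sval r)) [set:: B] = [set:: nonterminals (pre_rhs (sval r))].
Proof.
apply/setP => C; rewrite mem_bigcup_seq inE.
by rewrite (perm_mem (pre_nonterminals (new_rule_valid r))).
Qed.

Lemma new_start_sep r : new_start \notin nonterminals (pre_rhs (sval r)).
Proof.
rewrite (perm_mem (pre_nonterminals (new_rule_valid r))).
apply/negP => /flattenP[_ /mem_pre_links[i /andP[ip _] ->] /mem_block /= E].
by move: (start_notin_links (new_rule_valid r)); rewrite E ip.
Qed.

Definition footed_mcftg : mcftg Sigma :=
  @Mcftg Sigma piece_nt new_big new_start new_rule
    (fun r => pre_lhs (sval r)) (fun r => pre_rhs (sval r)) (fun r => pre_links (sval r))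
    (mcftg_maxrank G) new_big_nonempty new_big_uniq new_big_occ new_start_big new_start_rk
    new_rule_inj new_lhs_big (fun r => pre_rhs_pattern (new_rule_valid r))
    (fun r => pre_rhs_uniq (new_rule_valid r)) (fun r => pre_links_uniq (new_rule_valid r))
    new_links_big new_links_disjoint new_links_cover new_start_sep.

Local Notation G' := footed_mcftg.

(** * Footedness, multiplicity and lexicalization *)

Lemma footed_mcftg_footed : footed G'.
Proof.
move=> r; have [sz H] := pre_rhs_zip (new_rule_valid r).
by apply: zip_Forall2 => // x /H[_ /foot_footed].
Qed.

Lemma footed_mcftg_multiplicity : multiplicity G' <= multiplicity G * mr * (2 * width G - 1).
Proof.
apply/bigmax_leqP_seq => A /mem_new_big[i _ ->] _; rewrite size_block -mulnA.
exact: npieces_max.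
Qed.

(** The start symbol has rank 0, so its pattern is ground and its skeleton is a single node. *)
Lemma pre_index_start p : aligned p.1 p.2 -> lhs p.1 = [:: start G] -> pre_index p = start_index.
Proof.
move=> al El; have [E1 E2] := new_indexE al.
have := new_forest_pattern al; rewrite El in E1 *.
case E : (new_forest _ _) => [|t [|u l]] //=; last by rewrite andbF.
rewrite andbT => /andP[_].
rewrite mcftg_start_rk => /perm_size/size0nil t0.
apply: index_inj => //; rewrite E2 E /= dec_ground //; exact/groundP.
Qed.

(** All terminals of the old right-hand side survive the cut, so only properness has to be
    transferred: an initial terminal rule of [G] gives only initial terminal rules. *)
Lemma footed_mcftg_lexicalized (Delta : {set Sigma}) : lexicalized G Delta -> lexicalized G' Delta.
Proof.
move=> lexG r pr; have al := valid_aligned (new_rule_valid r).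
have [|s sD su] := lexG (sval r).1; last first.
  by exists s => //; apply: terminals_new.
apply: contra pr => /andP[/eqP El /eqP Ek]; apply/andP; split.
  by rewrite /initial_rule /= /pre_lhs (pre_index_start al El).
have j0 : (sval r).2 = [::] :> seq I by apply/nilP; rewrite /nilp -(size_map nt) al Ek.
by rewrite /terminal_rule /= /pre_links j0.
Qed.

(** * The transducers *)

Definition derives (i : I) (d : tree (rule_alphabet G) void) : Prop :=
  der_from (nt i) d /\ skeletons (Defs.val d) = skel i.

Lemma realizedP i : reflect (exists d, derives i d) (realized i).
Proof.
by apply: (iffP (asboolP _)) => [[d H1 H2]|[d [H1 H2]]]; exists d.
Qed.

Lemma der_fromE A (r : grule G) ds : der_from A (Node (r : rule_alphabet G) ds) ->
  [/\ A = lhs r, size (links r) = size ds & {in zip (links r) ds, forall x, der_from x.1 x.2}].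
Proof. by move=> H; inversion H as [r' ds' H']; subst; have [] := Forall2_zip H'. Qed.

(** The root rule fixes the big nonterminal and the value fixes the skeletons. This disjointness
    makes the forward transducer deterministic. *)
Lemma derives_inj i j d : derives i d -> derives j d -> i = j.
Proof.
case: d => [[]|r ds] [Hi Ei] [Hj Ej]; apply: index_inj; last by rewrite -Ei Ej.
by have [-> _ _] := der_fromE Hi; have [-> _ _] := der_fromE Hj.
Qed.

Lemma derives_exists A d : der_from A d -> exists2 i, nt i = A & derives i d.
Proof.
move=> H; have AG : A \in big G.
  by case: d H => [[]|r ds] /der_fromE[-> _ _]; apply: mcftg_lhs_big.
have p : (A, skeletons (Defs.val d)) \in index_seq.
  rewrite mem_index_seq AG; apply: skeletons_ok (val_patterns H).
  by move=> s; apply: (@leq_bigmax _ (fun s : Sigma => rk s)).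
by exists (SeqSub p).
Qed.

Lemma derives_list (Bs : seq (seq N)) ds : size Bs = size ds ->
  {in zip Bs ds, forall x, der_from x.1 x.2} ->
  exists js : seq I, [/\ map nt js = Bs, size js = size ds
    & {in zip js ds, forall x, derives x.1 x.2}].
Proof.
elim: Bs ds => [|B Bs IH] [|d ds] //= => [_ _|[sz] H]; first by exists [::].
have [|js [E1 E2 E3]] := IH ds sz; first by move=> x xz; apply: H; rewrite inE xz orbT.
have [i Ei di] := derives_exists (H (B, d) (mem_head _ _)).
exists (i :: js); rewrite /= E1 E2 Ei; split=> // x.
by rewrite inE => /predU1P[->|/E3].
Qed.

Lemma size_pieces_derives i d : derives i d -> size (block i) = size (pieces (Defs.val d)).
Proof. by case=> _ E; rewrite size_block size_pieces E. Qed.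

Lemma mem_zip_r (T U : eqType) (s : seq T) (t : seq U) x :
  size s = size t -> x \in s -> exists y, (x, y) \in zip s t.
Proof.
elim: s t => [|x0 s IH] [|y0 t] //= [sz]; rewrite inE => /predU1P[->|xs].
  by exists y0; rewrite mem_head.
by have [y H] := IH t sz xs; exists y; rewrite inE H orbT.
Qed.

Lemma zip_map2 (T U T' U' : Type) (f : T -> T') (h : U -> U') s t :
  zip (map f s) (map h t) = map (fun x => (f x.1, h x.2)) (zip s t).
Proof. by elim: s t => [|x s IH] [|y t] //=; rewrite IH. Qed.

(** One derivation step, shared by the look-ahead and both translations: [f] from [val_node] and the
    given [g] meet in [interprets], and soundness of the cut does the rest. *)
Lemma derives_step (r : grule G) js (ds : seq (tree (rule_alphabet G) void)) g :
  aligned r js -> size js = size ds ->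
  {in zip js ds, forall x, derives x.1 x.2 /\ map g (block x.1) = pieces (Defs.val x.2)} ->
  derives (new_index r js) (Node (r : rule_alphabet G) ds) /\
  pieces (Defs.val (Node (r : rule_alphabet G) ds)) = map (subst g) (pieces (new_forest r js)).
Proof.
move=> al sz H; have szl : size (links r) = size ds by rewrite -al size_map.
have zipE : zip (links r) ds = map (fun x => (nt x.1, x.2)) (zip js ds).
  by rewrite -al -[in LHS](map_id ds) zip_map2.
have Hd : {in zip (links r) ds, forall x, der_from x.1 x.2}.
  by move=> x; rewrite zipE => /mapP[y /H[[? _] _] ->].
have [|f vE fE] := val_node szl; first by move=> x /Hd/val_patterns/all2_size.
have Hi : {in js, forall i, interprets g i (map f (nt i))}.
  move=> i /(mem_zip_r sz)[d idz]; have [[di Ei] gi] := H _ idz.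
  have -> : map f (nt i) = Defs.val d.
    by apply: (fE (nt i, d)); rewrite zipE; apply: (map_f (fun x => (nt x.1, x.2)) idz).
  by split=> //; apply: val_patterns.
have [E1 E2] := new_indexE al; split; last by rewrite vE (pieces_new_forest al Hi).
split; first by rewrite E1; apply: der_from_node.
by rewrite vE (skeletons_new_forest al Hi) E2.
Qed.

Lemma derives_node (r : grule G) js (ds : seq (tree (rule_alphabet G) void)) :
  aligned r js -> size js = size ds -> {in zip js ds, forall x, derives x.1 x.2} ->
  derives (new_index r js) (Node (r : rule_alphabet G) ds).
Proof.
move=> al sz H; have ujs : uniq js by apply: (@map_uniq _ _ nt); rewrite al mcftg_links_uniq.
(* The index of the result does not mention [g], so any [g] naming the pieces will do; it looks each
   name up in the concatenated blocks. *)
have [|] := derives_step (g := fun C => nth (Leaf 0)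
   (flatten (map (fun x => pieces (Defs.val x.2)) (zip js ds)))
   (index C (flatten (map (fun x => block x.1) (zip js ds))))) al sz; last by [].
move=> x xz; split; first exact: H.
apply: map_index_flatten xz; last by move=> y /H/size_pieces_derives.
rewrite (map_comp block fst) -/unzip1 unzip1_zip ?sz //.
exact: flatten_blocks_uniq.
Qed.

Lemma derives_nodeP i (r : grule G) ds : derives i (Node (r : rule_alphabet G) ds) ->
  exists js, [/\ aligned r js, size js = size ds, {in zip js ds, forall x, derives x.1 x.2}
    & new_index r js = i].
Proof.
move=> di; have [H _] := di; have [_ sz Hd] := der_fromE H.
have [js [E1 E2 E3]] := derives_list sz Hd; exists js; split=> //.
exact: derives_inj (derives_node E1 E2 E3) di.
Qed.

(** The state of a derivation tree is its unique index; all other trees get [None]. *)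
Definition look_delta (r : rule_alphabet G) (os : seq (option I)) : option I :=
  if all isSome os && (map nt (pmap id os) == links (r : grule G))
  then Some (new_index r (pmap id os)) else None.

Lemma run_look_delta d i : run look_delta d = Some i <-> derives i d.
Proof.
elim/tree_nested_ind: d i => [[]|r ds IH] i; split.
  rewrite /= /look_delta; case: ifP => // /andP[ds_some /eqP al] [<-].
  set js := pmap _ _ in al *.
  have Ejs : map Some js = map (run look_delta) ds.
    rewrite /js; elim: ds ds_some {IH js al} => //= d ds IHds.
    by case: (run _ d) => //= j /IHds ->.
  have sz : size js = size ds by rewrite -(size_map Some) Ejs size_map.
  apply: derives_node => // -[j d] jdz /=; apply/IH.
    by have <- : unzip2 (zip js ds) = ds by [rewrite unzip2_zip ?sz]; apply: (map_f snd jdz).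
  have : (Some j, run look_delta d) \in zip (map Some js) (map (run look_delta) ds).
    by rewrite zip_map2; apply: (map_f (fun x => (Some x.1, run look_delta x.2)) jdz).
  rewrite Ejs; elim: (map _ ds) => //= o os IHo; rewrite inE => /predU1P[[-> ->] //|/IHo].
  exact.
move=> /derives_nodeP[js [al sz H <-]] /=.
have -> : map (run look_delta) ds = map Some js.
  elim: ds js sz H IH {al} => [|d ds IHds] [|j js] //= [sz] H IH.
  have /IH -> := H (j, d) (mem_head _ _); rewrite ?mem_head //.
  congr cons; apply: IHds => // [x xz|u uds]; first by apply: H; rewrite inE xz orbT.
  by apply: IH; rewrite inE uds orbT.
rewrite /look_delta; have -> : pmap id (map Some js) = js by elim: (js) => //= j l ->.
by rewrite al eqxx andbT all_map /=; case: allP => // -[].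
Qed.

Lemma derives_ranked i d : derives i d -> ranked (@rk (rule_alphabet G)) d.
Proof. by case=> /der_ranked. Qed.

Lemma derives_regular i : regular (Omega := rule_alphabet G) (derives i).
Proof.
exists (option I), look_delta, [set Some i] => d; rewrite inE.
split=> [di|[_ /eqP/run_look_delta]] //; split; first exact: derives_ranked di.
by apply/eqP/run_look_delta.
Qed.

Lemma ranked_regular (Omega : rankedAlphabet) :
  regular (fun d : tree Omega void => ranked (@rk Omega) d).
Proof.
exists unit, (fun _ _ => tt), [set: unit] => d; rewrite inE.
by split=> [|[]].
Qed.

(** A ground tree is its own only piece, so at the start symbol equality of pieces becomes equality
    of values. *)
Lemma start_indexP d : der_from [:: start G] d ->
  derives start_index d /\ pieces (Defs.val d) = Defs.val d.
Proof.
move=> H; have := val_patterns H.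
case E : (Defs.val d) => [|t [|u l]] //=; last by rewrite andbF.
rewrite andbT => /andP[_]; rewrite mcftg_start_rk => /perm_size/size0nil/groundP t0.
by rewrite /derives E /skeletons /pieces /= !dec_ground.
Qed.

Lemma uniq_index_map (T : eqType) (s l : seq T) : uniq l -> {subset l <= s} ->
  uniq (map (index^~ s) l).
Proof.
move=> ul ls; rewrite map_inj_in_uniq // => x y xl yl E.
by rewrite -(nth_index x (ls _ xl)) E nth_index // ls.
Qed.

Lemma onth_some T (x : T) s k : k < size s -> onth s k = Some (nth x s k).
Proof. by elim: s k => [|y s IH] [|k] //= /IH. Qed.

Lemma onth_nth T (x : T) s k y : onth s k = Some y -> k < size s /\ nth x s k = y.
Proof. by elim: s k => [|z s IH] [|k] //= => [[->]|/IH]. Qed.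

Lemma zip_functional (T U : eqType) (s : seq T) (t : seq U) x y y' : uniq s ->
  (x, y) \in zip s t -> (x, y') \in zip s t -> y = y'.
Proof.
have zl a b s' t' : (a, b) \in zip s' t' -> a \in (s' : seq T).
  by elim: s' t' => [|c s' IH] [|e t'] //=; rewrite !inE => /predU1P[[-> _]|/IH ->];
    rewrite ?eqxx ?orbT.
elim: s t => [|z s IH] [|w t] //= /andP[zs us].
rewrite !inE => /orP[/eqP[Ex Ey]|xy] /orP[/eqP[Ex' Ey']|xy'].
- by rewrite Ey Ey'.
- by case/negP: zs; rewrite -Ex; apply: zl xy'.
- by case/negP: zs; rewrite -Ex'; apply: zl xy.
exact: IH us xy xy'.
Qed.

(** * The transducer into the footed grammar *)

Definition pre_pos p (B : seq piece_nt) : nat := index B (map block p.2).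

(** [B] is a live block, so the index found is the one position in [p.2] with this block; dead
    positions carry the empty block. *)
Lemma pre_posP p B : B \in pre_links p ->
  exists i, [/\ B = block i, live i, pre_pos p B < size p.2
    & onth p.2 (pre_pos p B) = Some i].
Proof.
move=> /mem_pre_links[i /andP[ip li] EB]; exists i.
have Bm : B \in map block p.2 by rewrite EB map_f.
have lt : pre_pos p B < size p.2 by rewrite -(size_map block) index_mem.
split=> //; rewrite (onth_some i lt); congr Some.
by apply/esym/block_inj => //; rewrite -EB -(nth_map i [::]) // nth_index.
Qed.

Lemma pre_links_sub p : {subset pre_links p <= map block p.2}.
Proof. by move=> B /mem_pre_links[i /andP[ip _] ->]; apply: map_f. Qed.

(** All valid guesses and not only representatives: the transducer reads the actual rule of [G] and
    outputs the representative. *)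
Definition valid_rule : finType := {p : prerule | valid p}.

Lemma rep_subproof (v : valid_rule) : valid (rep (sval v)) && (rep (rep (sval v)) == rep (sval v)).
Proof. by case: v => p /= /repP[-> _ ->]. Qed.

Definition rep_rule (v : valid_rule) : new_rule := exist _ (rep (sval v)) (rep_subproof v).

Definition fwd_look (v : valid_rule) (k : nat) (d : tree (rule_alphabet G) void) : Prop :=
  match k with
  | 0 => ranked (@rk (rule_alphabet G)) d
  | j.+1 => if onth (sval v).2 j is Some i then derives i d
            else ranked (@rk (rule_alphabet G)) d
  end.

(** The representative may come from another rule and list its links in another order, so each link
    is sent to the child that derives it. Children with dead indices are deleted. *)
Definition fwd_zeta (v : valid_rule) : tree (rule_alphabet G') (unit * nat) :=
  Node (rep_rule v : rule_alphabet G')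
    [seq Leaf (tt, pre_pos (sval v) B) | B <- pre_links (rep (sval v))].

Lemma rep_links_perm (v : valid_rule) :
  perm_eq (pre_links (rep (sval v))) (pre_links (sval v)).
Proof. by case: v => p /= /repP[_ /and3P[]]. Qed.

Lemma fwd_regular v k : k <= size (links (sval v).1) ->
  regular (Omega := rule_alphabet G) (fwd_look v k).
Proof.
move=> _; case: k => [|k]; rewrite /fwd_look; first exact: ranked_regular.
by case: (onth (sval v).2 k) => [i|]; [apply: derives_regular | apply: ranked_regular].
Qed.

Lemma fwd_ranked v : ranked (@rk (rule_alphabet G')) (fwd_zeta v).
Proof. by rewrite /= size_map eqxx /= all_map; apply/allP. Qed.

Lemma leaves_map_Leaf A X Y (f : Y -> X) (l : seq Y) (a : A) :
  leaves (Node a [seq Leaf (f y) | y <- l]) = map f l.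
Proof. by rewrite /= -map_comp; elim: l => //= y l ->. Qed.

Lemma fwd_bound v (q : unit) k : (q, k) \in leaves (fwd_zeta v) -> k < size (links (sval v).1).
Proof.
rewrite leaves_map_Leaf => /mapP[B]; rewrite (perm_mem (rep_links_perm v)).
move=> /pre_posP[i [_ _ lt _]] [_ ->].
by rewrite -(valid_aligned (svalP v)) size_map.
Qed.

Lemma fwd_linear v : uniq (map snd (leaves (fwd_zeta v))).
Proof.
rewrite leaves_map_Leaf -map_comp; apply: uniq_index_map.
  by rewrite (perm_uniq (rep_links_perm v)) pre_links_uniq // (svalP v).
by move=> B; rewrite (perm_mem (rep_links_perm v)); apply: pre_links_sub.
Qed.

(** If no look-ahead separated the two guesses, [derives_inj] would make them equal at every
    position. *)
Lemma fwd_deterministic (v w : valid_rule) : v != w -> tt = tt ->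
  (sval v).1 = (sval w).1 ->
  exists2 k, k <= size (links (sval v).1) & forall d, ~ (fwd_look v k d /\ fwd_look w k d).
Proof.
move=> /eqP vw _ E1; apply: contrapT => H; apply: vw; apply: val_inj.
have sv : size (sval v).2 = size (links (sval v).1).
  by rewrite -(valid_aligned (svalP v)) size_map.
have sw : size (sval w).2 = size (links (sval v).1).
  by rewrite E1 -(valid_aligned (svalP w)) size_map.
rewrite [RHS]surjective_pairing [LHS]surjective_pairing E1; congr pair; apply: val_inj.
(* Look-ahead 0 concerns the whole tree, hence the shift to [j.+1] for child [j]. *)
apply: (@eq_from_nth _ start_index); first by rewrite sv sw.
move=> j lj; apply: contrapT => ne; apply: H; exists j.+1; first by rewrite -sv.
have lj' : j < size (sval w).2 by rewrite sw -sv.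
by move=> d; rewrite /fwd_look (onth_some start_index lj) (onth_some start_index lj') => -[/derives_inj H /H].
Qed.

Definition fwd : ldtr (rule_alphabet G) (rule_alphabet G') :=
  @Ldtr (rule_alphabet G) (rule_alphabet G') unit tt valid_rule (fun _ => tt)
    (fun v => (sval v).1 : rule_alphabet G) fwd_look fwd_zeta
    fwd_regular fwd_ranked fwd_bound fwd_linear fwd_deterministic.

Lemma max_links_le (r : grule G) (js : seq I) : aligned r js -> size js <= max_links.
Proof.
move=> /(congr1 size); rewrite size_map => ->.
exact: (@leq_bigmax _ (fun r : grule G => size (links r))).
Qed.

Lemma new_val_node (q : new_rule) ds' :
  size (pre_links (sval q)) = size ds' ->
  {in zip (pre_links (sval q)) ds', forall x, size x.1 = size (Defs.val (G := G') x.2)} ->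
  exists2 g : piece_nt -> tree Sigma nat,
    Defs.val (Node (q : rule_alphabet G') ds') = map (subst g) (pre_rhs (sval q)) &
    {in zip (pre_links (sval q)) ds', forall x, map g x.1 = Defs.val (G := G') x.2}.
Proof.
move=> sz szp; have [g vE gE] := val_node (G := G') (r := q) sz szp.
exists g => //; rewrite vE; apply/eq_in_map => t /(rhs_ranked (G := G')) rt.
by rewrite subst_gsubst.
Qed.

Lemma fwd_main d i : derives i d -> live i ->
  exists d', [/\ transduces (M := fwd) tt d d', der_from (G := G') (block i) d'
    & Defs.val (G := G') d' = pieces (Defs.val d)].
Proof.
elim/tree_nested_ind: d i => [[]|r ds IH] i di li.
have [js [al sz H Ei]] := derives_nodeP di.
pose p : prerule := (r, Bseq (max_links_le al)).
have vp : valid p.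
  apply/and3P; split; first exact/eqP.
    apply/allP => j /(mem_zip_r sz)[d /H dj]; by apply/realizedP; exists d.
  by rewrite /pre_index /= Ei.
pose v : valid_rule := exist _ p vp.
have ujs : uniq js := valid_uniq vp.
(* Outputs can be chosen per index rather than per position, because [js] is repetition-free and so
   determines the child. *)
have [h hP] : {h : I -> tree (rule_alphabet G') void &
    forall j d, (j, d) \in zip js ds -> live j ->
    [/\ transduces (M := fwd) tt d (h j), der_from (G := G') (block j) (h j)
    & Defs.val (G := G') (h j) = pieces (Defs.val d)]}.
  apply: (choice (P := fun j d' => forall d, (j, d) \in zip js ds -> live j ->
    [/\ transduces (M := fwd) tt d d', der_from (G := G') (block j) d'
    & Defs.val (G := G') d' = pieces (Defs.val d)])) => j.
  have [[d [jd lj]]|no] := pselect (exists d, (j, d) \in zip js ds /\ live j); last first.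
    exists (Node (rep_rule v : rule_alphabet G') [::]) => d jd lj.
    by case: no; exists d.
  have dds : d \in ds by have <- : unzip2 (zip js ds) = ds by [rewrite unzip2_zip ?sz]; apply: (map_f snd jd).
  have [d' d'P] := IH d dds j (H _ jd) lj.
  by exists d' => d1 jd1 _; rewrite (zip_functional ujs jd1 jd).
pose H' k := h (nth i js k).
have posE B : B \in pre_links (rep p) -> exists j d,
    [/\ B = block j, live j, H' (pre_pos p B) = h j & (j, d) \in zip js ds].
  rewrite (perm_mem (rep_links_perm v)) => /pre_posP[j [EB lj lt /(onth_nth i)[_ nj]]].
  have jjs : j \in js by rewrite -nj mem_nth.
  by have [d jd] := mem_zip_r sz jjs; exists j, d; rewrite /H' nj.
pose ds' := [seq H' (pre_pos p B) | B <- pre_links (rep p)].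
have zE : zip (pre_links (rep p)) ds' = [seq (B, H' (pre_pos p B)) | B <- pre_links (rep p)].
  by rewrite /ds'; elim: (pre_links (rep p)) => //= B l ->.
have dP x : x \in zip (pre_links (rep p)) ds' -> exists j d,
    [/\ x.1 = block j, live j, x.2 = h j & (j, d) \in zip js ds].
  by rewrite zE => /mapP[B /posE[j [d [EB lj Eh jd]]] ->]; exists j, d; split=> /=.
have szl : size (pre_links (rep p)) = size ds' by rewrite /ds' size_map.
have [|g vE gE] := new_val_node (q := rep_rule v) szl.
  move=> [B d'] /dP[j [d [/= -> lj -> jd]]]; have [_ _ ->] := hP _ _ jd lj.
  exact: size_pieces_derives (H _ jd).
have [_ /and3P[/eqP El /eqP Er _] _] := repP vp.
have [_ pE] : derives (new_index r js) (Node (r : rule_alphabet G) ds) /\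
    pieces (Defs.val (Node (r : rule_alphabet G) ds)) = map (subst g) (pieces (new_forest r js)).
  apply: derives_step => // -[j d] jdz /=; have dj := H _ jdz; split=> //.
  (* [g] is controlled only on live blocks; for a dead index both the block and the sequence of
     pieces are empty. *)
  have [lj|nlj] := boolP (live j); last first.
    have := size_pieces_derives dj; have := blockP j; rewrite (negbTE nlj) => /negbFE/eqP ->.
    by move/esym/size0nil ->.
  have jjs : j \in js by have <- : unzip1 (zip js ds) = js by [rewrite unzip1_zip ?sz]; apply: (map_f fst jdz).
  have Bp : block j \in pre_links (rep p).
    by rewrite (perm_mem (rep_links_perm v)); apply/mem_pre_links; exists j; rewrite // lj andbT.
  have := gE (block j, H' (pre_pos p (block j))); rewrite zE => /(_ (map_f _ Bp)) /= ->.
  have [j' [d1 [Ej lj' -> jd1]]] := posE _ Bp.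
  have Ejj : j = j' by apply: (block_inj lj); rewrite Ej.
  rewrite -Ejj in jd1 *.
  by have [_ _ ->] := hP _ _ jd1 lj; rewrite (zip_functional ujs jd1 jdz).
exists (Node (rep_rule v : rule_alphabet G') ds'); split.
- have <- : graft (fun x : unit * nat => H' x.2) (fwd_zeta v) =
      Node (rep_rule v : rule_alphabet G') ds' by rewrite /= -map_comp.
  apply: (@Transduces _ _ fwd v ds (fun x => H' x.2)).
  + exact: derives_ranked di.
  + move=> k d od; rewrite /=; case ok: (onth js k) => [j|].
      have [lk nj] := onth_nth i ok; have [_ nd] := onth_nth d od.
      by apply: (H (j, d)); rewrite -nj -nd -nth_zip // mem_nth // size_zip -sz minnn.
    have [lk _] := onth_nth d od; rewrite -sz in lk.
    by rewrite (onth_some i lk) in ok.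
  move=> [] k d; rewrite leaves_map_Leaf => /mapP[B Bp [->]] od.
  have [j [d1 [EB lj -> jd1]]] := posE _ Bp.
  have [j0 [EB0 lj0 lt /(onth_nth i)[_ nj]]] :=
    pre_posP (etrans (esym (perm_mem (rep_links_perm v) B)) Bp).
  have [_ nd] := onth_nth d od.
  have jd : (j0, d) \in zip js ds by rewrite -nj -nd -nth_zip // mem_nth // size_zip -sz minnn.
  have Ej : j0 = j by apply: (block_inj lj0); rewrite -EB0 EB.
  by rewrite Ej in jd; have [] := hP j d jd lj.
- rewrite -Ei -[new_index r js]/(pre_index p) -[block _]/(pre_lhs p) -El.
  apply: (der_from_node (G := G') (r := rep_rule v)) => // -[B d'] /dP[j [d [/= -> lj -> jd]]].
  by have [_ ? _] := hP _ _ jd lj.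
by rewrite vE pE Er.
Qed.

Lemma fwd_translates : ldtr_translates fwd.
Proof.
move=> d /start_indexP[ds pd]; have [//|d' [td dd vd]] := fwd_main ds.
by exists d'; split=> //; rewrite vd.
Qed.

(** * The transducer back to the original grammar *)

Definition witness (r : grule G) (i : I) : tree (rule_alphabet G) void :=
  match pselect (exists d, derives i d) with
  | left h => sval (cid h)
  | right _ => Node (r : rule_alphabet G) [::]
  end.

Lemma witnessP (r : grule G) i : realized i -> derives i (witness r i).
Proof. by move=> /realizedP h; rewrite /witness; case: pselect => // ?; case: cid. Qed.

Lemma leaves_void A (t : tree A void) : leaves t = [::].
Proof. by case: (leaves t) => // -[]. Qed.

Lemma graft_void A X (f : void -> tree A X) (g : X -> tree A void) t :
  graft g (graft f t) = t.
Proof.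
rewrite graft_graft -[RHS]graft_Leaf; apply: eq_in_graft => x.
by rewrite leaves_void.
Qed.

(* Links that disappeared because all their patterns were [x_1] are restored
   with a fixed derivation tree. *)
Definition bwd_child (q : new_rule) (i : I) : tree (rule_alphabet G) (unit * nat) :=
  if live i then Leaf (tt, index (block i) (pre_links (sval q)))
  else graft (of_void _) (witness (sval q).1 i).

Definition bwd_zeta (q : new_rule) : tree (rule_alphabet G) (unit * nat) :=
  Node ((sval q).1 : rule_alphabet G) (map (bwd_child q) (sval q).2).

(** The input symbol already records a rule of [G] and the guessed indices, so the look-ahead only
    asks for ranked trees. *)
Definition bwd_look (q : new_rule) (k : nat) (d : tree (rule_alphabet G') void) : Prop :=
  ranked (@rk (rule_alphabet G')) d.

Lemma bwd_regular q k : k <= size (pre_links (sval q)) ->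
  regular (Omega := rule_alphabet G') (bwd_look q k).
Proof. by move=> _; apply: ranked_regular. Qed.

Lemma bwd_ranked q : ranked (@rk (rule_alphabet G)) (bwd_zeta q).
Proof.
have vq := new_rule_valid q; rewrite /= size_map -(valid_aligned vq) size_map eqxx /= all_map.
apply/allP => i iq /=; rewrite /bwd_child; case: (live i) => //.
have ri : realized i by case/and3P: vq => _ /allP/(_ i iq).
by apply: ranked_graft => [|[]]; apply: derives_ranked (witnessP _ ri).
Qed.

Lemma leaves_bwd q : leaves (bwd_zeta q) =
  [seq (tt, index B (pre_links (sval q))) | B <- pre_links (sval q)].
Proof.
rewrite /= {2}/pre_links -map_comp; elim: ((sval q).2 : seq I) => //= i l ->.
by rewrite {1}/bwd_child; case: (live i) => //=; rewrite leaves_graft leaves_void.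
Qed.

Lemma bwd_bound q (s : unit) k : (s, k) \in leaves (bwd_zeta q) -> k < size (pre_links (sval q)).
Proof. by rewrite leaves_bwd => /mapP[B Bq [_ ->]]; rewrite index_mem. Qed.

Lemma bwd_linear q : uniq (map snd (leaves (bwd_zeta q))).
Proof.
by rewrite leaves_bwd -map_comp; apply: uniq_index_map => //; apply: pre_links_uniq (new_rule_valid q).
Qed.

Lemma bwd_deterministic (q q' : new_rule) : q != q' -> tt = tt -> q = q' ->
  exists2 k, k <= size (pre_links (sval q)) & forall d, ~ (bwd_look q k d /\ bwd_look q' k d).
Proof. by move=> /eqP ne _ /ne. Qed.

Definition bwd : ldtr (rule_alphabet G') (rule_alphabet G) :=
  @Ldtr (rule_alphabet G') (rule_alphabet G) unit tt new_rule (fun _ => tt)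
    (fun q => q : rule_alphabet G') bwd_look bwd_zeta
    bwd_regular bwd_ranked bwd_bound bwd_linear bwd_deterministic.

Lemma new_der_fromE A (q : new_rule) ds : der_from (G := G') A (Node (q : rule_alphabet G') ds) ->
  [/\ A = pre_lhs (sval q), size (pre_links (sval q)) = size ds
    & {in zip (pre_links (sval q)) ds, forall x, der_from (G := G') x.1 x.2}].
Proof. by move=> H; inversion H as [r' ds' H']; subst; have [] := Forall2_zip H'. Qed.

Lemma bwd_main d' i : live i -> der_from (G := G') (block i) d' ->
  exists d, [/\ transduces (M := bwd) tt d' d, derives i d
    & Defs.val (G := G') d' = pieces (Defs.val d)].
Proof.
(* The rebuilt tree may differ from the one that [d'] was translated from. Only index and pieces
   matter, and a restored dead link contributes no piece. *)
elim/tree_nested_ind: d' i => [[]|q ds' IH] i li Hd.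
have [Ei sz H] := new_der_fromE Hd; set p := sval q in Ei sz H.
have vp : valid p by exact: new_rule_valid.
have {}Ei : i = pre_index p by apply: block_inj => //; rewrite Ei.
have al := valid_aligned vp.
have uL := pre_links_uniq vp.
have [h hP] : {h : I -> tree (rule_alphabet G) void &
    forall j e, (block j, e) \in zip (pre_links p) ds' -> live j ->
    [/\ transduces (M := bwd) tt e (h j), derives j (h j)
    & Defs.val (G := G') e = pieces (Defs.val (h j))]}.
  apply: (choice (P := fun j d => forall e, (block j, e) \in zip (pre_links p) ds' -> live j ->
    [/\ transduces (M := bwd) tt e d, derives j d
    & Defs.val (G := G') e = pieces (Defs.val d)])) => j.
  have [[e [je lj]]|no] := pselect (exists e, (block j, e) \in zip (pre_links p) ds' /\ live j); last first.
    exists (Node (p.1 : rule_alphabet G) [::]) => e je lj.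
    by case: no; exists e.
  have eds : e \in ds'.
    by have <- : unzip2 (zip (pre_links p) ds') = ds' by [rewrite unzip2_zip ?sz]; apply: (map_f snd je).
  have [d dP] := IH e eds j lj (H _ je).
  by exists d => e1 je1 _; rewrite (zip_functional uL je1 je).
(* Live children come from the induction hypothesis, dead ones from fixed witnesses, which exist
   since valid rules have realized links. *)
pose ds := [seq if live j then h j else witness p.1 j | j <- p.2].
have linkE j : j \in p.2 -> live j -> exists e, (block j, e) \in zip (pre_links p) ds'.
  by move=> jp lj; apply: (mem_zip_r sz); apply/mem_pre_links; exists j; rewrite ?jp.
have dj j : j \in p.2 -> derives j (if live j then h j else witness p.1 j).
  move=> jp; case: ifP => lj; first by have [e /hP/(_ lj)[]] := linkE j jp lj.
  by apply: witnessP; case/and3P: vp => _ /allP/(_ j jp).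
have szL : {in zip (pre_links p) ds', forall x, size x.1 = size (Defs.val (G := G') x.2)}.
  move=> [B e] xz; have BL : B \in pre_links p.
    by have <- : unzip1 (zip (pre_links p) ds') = pre_links p by [rewrite unzip1_zip ?sz]; apply: (map_f fst xz).
  have [j /andP[jp lj] EB] := mem_pre_links p B BL.
  rewrite EB in xz *; have [_ dh ->] := hP j e xz lj; exact: size_pieces_derives.
have [g vE gE] := new_val_node (q := q) sz szL.
have [dN pE] : derives (new_index p.1 p.2) (Node (p.1 : rule_alphabet G) ds) /\
    pieces (Defs.val (Node (p.1 : rule_alphabet G) ds)) =
    map (subst g) (pieces (new_forest p.1 p.2)).
  apply: derives_step => //; first by rewrite size_map.
  move=> x; rewrite /ds -[X in zip X _]map_id zip_map => /mapP[j jp ->] /=.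
  split; first exact: dj.
  have := dj j jp; case: ifP => [lj _|nlj].
    by have [e je] := linkE j jp lj; have [_ _ <-] := hP j e je lj; apply: (gE _ je).
  move=> /size_pieces_derives; have := blockP j; rewrite nlj => /negbFE/eqP ->.
  by move/esym/size0nil ->.
exists (Node (p.1 : rule_alphabet G) ds); split; last first.
- by rewrite vE pE.
- by rewrite Ei.
(* The leaf numbered [k] in [bwd_zeta] refers to link [k] of the new rule, which is the block of the
   live index at position [k] among the live ones. *)
pose g0 (x : unit * nat) := h (nth i [seq j <- p.2 | live j] x.2).
have posE j : j \in p.2 -> live j -> nth i [seq j <- p.2 | live j] (index (block j) (pre_links p)) = j.
  move=> jp lj; have BL : block j \in pre_links p.
    by apply/mem_pre_links; exists j; rewrite ?jp.
  apply/esym/(block_inj lj); have lt := BL; rewrite -index_mem in lt.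
  by rewrite -(nth_map i [::]) ?nth_index //; rewrite size_map in lt.
have <- : graft g0 (bwd_zeta q) = Node (p.1 : rule_alphabet G) ds.
  rewrite /= -map_comp; congr Node; apply/eq_in_map => j jp /=; rewrite /bwd_child.
  by case: ifP => lj; [rewrite /= /g0 /= posE | rewrite graft_void].
have onth_zip k e : onth ds' k = Some e -> (nth [::] (pre_links p) k, e) \in zip (pre_links p) ds'.
  by move=> /(onth_nth e)[lt <-]; rewrite -nth_zip // mem_nth // size_zip sz minnn.
apply: (@Transduces _ _ bwd q ds' g0).
- exact: der_ranked Hd.
- by move=> k e /onth_zip/H/der_ranked.
move=> [] k e; rewrite leaves_bwd => /mapP[B BL [->]] /onth_zip; rewrite nth_index // => Be.
have [j /andP[jp lj] EB] := mem_pre_links p B BL.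
rewrite EB in Be *; rewrite /g0 /= posE //.
by have [] := hP j e Be lj.
Qed.

Lemma bwd_translates : ldtr_translates bwd.
Proof.
move=> d' dd'; have [//|d [td di vd]] := @bwd_main d' start_index _ dd'.
have dd : der d by case: di.
by have [_ pd] := start_indexP dd; exists d; split=> //; rewrite vd pd.
Qed.

End Construction.

Theorem theorem49 (Sigma : rankedAlphabet) (G : mcftg Sigma)
    (hwidth : 1 <= width G) :
  exists G' : mcftg Sigma,
    [/\ ldtr_equivalent G G',
        footed G',
        multiplicity G' <= multiplicity G * maxrank Sigma * (2 * width G - 1) &
        forall Delta : {set Sigma}, lexicalized G Delta -> lexicalized G' Delta].
Proof.
exists (footed_mcftg hwidth); split.
- by split; [exists (fwd hwidth); apply: fwd_translates | exists (bwd hwidth); apply: bwd_translates].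
- exact: footed_mcftg_footed.
- exact: footed_mcftg_multiplicity.
exact: footed_mcftg_lexicalized.
Qed.
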